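(* Let $G$ be a noncompact reductive Lie group of nonexceptional type with maximal compact subgroup $K$, with Lie algebras $\mathfrak{g}$ and $\mathfrak{k}$, such that if $\mathfrak{c}$ denotes the center of $\mathfrak{k}$, then the centralizer of $\mathfrak{c}$ in $\mathfrak{g}$ satisfies $Z_{\mathfrak{g}}(\mathfrak{c})=\mathfrak{k}$. In the case $G\simeq\mathrm{Sp}(m,\mathbb{R})$, take the realization $G=\mathrm{Sp}(m,\mathbb{C})\cap\mathrm{SU}(m,m)$. Suppose $\mathscr{D}=\{g_j\in G: 1\leq j\leq n\}$ is such that, writing $g_j^{-1}=\begin{pmatrix}A_j&B_j\\C_j&D_j\end{pmatrix}$, the numbers $\det D_j$ are distinct as $j$ traverses $1,\ldots,n$. Let $f:\mathscr{D}\to\mathbb{C}$ be a nonconstant function. For $g\in G$ with $g^{-1}=\begin{pmatrix}*&*\\ *&D\end{pmatrix}$, where $\det D\neq 0$, define $\psi_\lambda(g)=\det(D)^{-\lambda}$ for integers $\lambda$. Then there are $a_\lambda\in\mathbb{C}$, with $\lambda$ running over a finite set of integers, such that $$W_{f,\mathscr{D}}(g)=\sum_\lambda a_\lambda\psi_\lambda(g)$$ is a holomorphic, square integrable Whitney extension of $f$, i.e. in particular $W_{f,\mathscr{D}}(g)=f(g)$ for all $g\in\mathscr{D}$.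
   Context: The groups of the theorem are, by the classification of noncompact Hermitian symmetric spaces of classical type, $\mathrm{SU}(p,q)$, $\mathrm{Sp}(m,\mathbb{R})$, $\mathrm{SO}^*(2m)$ and $\mathrm{SO}(p,2)^\circ$, with their natural $2\times 2$ block forms: the lower right block $D$ is $q\times q$ for $\mathrm{SU}(p,q)$, $m\times m$ for $\mathrm{Sp}(m,\mathbb{C})\cap\mathrm{SU}(m,m)=\{g\in\mathrm{SU}(m,m): g^tJg=J\}$ with $J=\begin{pmatrix}0&I_m\\-I_m&0\end{pmatrix}$, $m\times m$ for $\mathrm{SO}^*(2m)$ realized inside $\mathrm{SU}(m,m)$, and $2\times2$ for $\mathrm{SO}(p,2)^\circ$; in all cases $\det D\neq0$. ''Square integrable'' means with respect to Haar measure on $G$. ''Holomorphic'' is the paper's term for these extensions; the $\psi_\lambda$ are matrix coefficients of the form $\langle\pi_\lambda(g)1,1\rangle_\lambda$ of scalar holomorphic discrete series representations $\pi_\lambda$ of $G$ realized on holomorphic functions on the bounded symmetric domain $G/K$.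
   Formalization: For G = SO(p,2)°, the ψ_λ are taken as matrix coefficients of scalar holomorphic discrete series of SU(p,2) restricted to G, since det D = 1 on K makes ψ_λ bi-K-invariant and so never a coefficient of such a series of G itself. *)

(* Defs.v *)
From HB Require Import structures.
From mathcomp Require Import all_boot all_order all_algebra.
From mathcomp Require Import complex.
From mathcomp Require Import all_classical all_reals all_analysis.

Set Implicit Arguments.
Unset Strict Implicit.
Unset Printing Implicit Defensive.

Import Order.TTheory GRing.Theory Num.Theory.
Import numFieldNormedType.Exports.

Local Open Scope classical_set_scope.
Local Open Scope ring_scope.
Local Open Scope complex_scope.

(* R[i] carries the topology and the norm of a numFieldType, which are not
   inferred by unification on the type R[i] itself. *)
HB.instance Definition _ (R : realType) := PseudoPointedMetric.copy R[i] R[i]^o.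
HB.instance Definition _ (R : realType) := NormedModule.copy R[i] R[i]^o.

Section MatrixGroups.
Variable R : realType.

Definition Ipq p q : 'M[R[i]]_(p + q) := block_mx 1%:M 0 0 (- 1%:M).

Definition SU p q : set 'M[R[i]]_(p + q) :=
  [set g | (g ^t*)%sesqui *m Ipq p q *m g = Ipq p q /\ \det g = 1].
Arguments SU p q _ : clear implicits.

(* The realization of Sp(m, R) as Sp(m, C) `&` SU(m, m). *)
Definition Sp m : set 'M[R[i]]_(m + m) :=
  let J := block_mx 0 1%:M (- 1%:M) 0 in
  SU m m `&` [set g | g^T *m J *m g = J].
Arguments Sp m _ : clear implicits.

Definition SOstar m : set 'M[R[i]]_(m + m) :=
  let S := block_mx 0 1%:M 1%:M 0 in
  SU m m `&` [set g | g^T *m S *m g = S].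
Arguments SOstar m _ : clear implicits.

(* For real g, g ^t* = g^T, so these are the real matrices of determinant 1
   preserving the quadratic form of signature (p, q). *)
Definition SO p q : set 'M[R[i]]_(p + q) :=
  SU p q `&` [set g | forall i j, complex.Im (g i j) = 0].
Arguments SO p q _ : clear implicits.

Definition compact_subgroup n (G K : set 'M[R[i]]_n) : Prop :=
  [/\ K `<=` G, compact K, K 1%:M,
      forall g h, K g -> K h -> K (g *m h) & forall g, K g -> K (invmx g)].

Definition maximal_compact_subgroup n (G K : set 'M[R[i]]_n) : Prop :=
  compact_subgroup G K /\
  forall L, compact_subgroup G L -> K `<=` L -> L = K.

Definition mexp n (X : 'M[R[i]]_n) : 'M[R[i]]_n :=
  limn (series (fun k : nat => k`!%:R^-1 *: X ^+ k)).

Definition lie n (G : set 'M[R[i]]_n) : set 'M[R[i]]_n :=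
  [set X | forall t : R, G (mexp (t%:C *: X))].

Definition lie_centralizer n (g c : set 'M[R[i]]_n) : set 'M[R[i]]_n :=
  [set X | g X /\ forall Y, c Y -> X *m Y = Y *m X].

Definition lie_center n (k : set 'M[R[i]]_n) : set 'M[R[i]]_n := lie_centralizer k k.

End MatrixGroups.

#[global] Arguments SU R p q _ : clear implicits.
#[global] Arguments Sp R m _ : clear implicits.
#[global] Arguments SOstar R m _ : clear implicits.
#[global] Arguments SO R p q _ : clear implicits.

(* Classical types of noncompact Hermitian symmetric spaces. No bounds are put
   on the parameters: compact members of the families are excluded by the
   noncompactness hypothesis on the group. *)
Inductive hermitian_type : Type :=
  | TypeSU of nat & nat
  | TypeSp of nat
  | TypeSOstar of nat
  | TypeSO2 of nat.

(* Sizes of the upper left and lower right diagonal blocks. *)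
Definition ulsize (T : hermitian_type) : nat :=
  match T with
  | TypeSU p _ => p | TypeSp m => m | TypeSOstar m => m | TypeSO2 p => p
  end.

Definition drsize (T : hermitian_type) : nat :=
  match T with
  | TypeSU _ q => q | TypeSp m => m | TypeSOstar m => m | TypeSO2 _ => 2
  end.

Section HermitianGroups.
Variable R : realType.

Definition hermitian_group (T : hermitian_type) :
    set 'M[R[i]]_(ulsize T + drsize T) :=
  match T with
  | TypeSU p q => SU R p q
  | TypeSp m => Sp R m
  | TypeSOstar m => SOstar R m
  | TypeSO2 p => connected_component (SO R p 2) 1%:M
  end.
Arguments hermitian_group T _ : clear implicits.

(* The group whose scalar holomorphic discrete series has the functions psi as
   matrix coefficients: the group itself, except for SO(p, 2)^o. On the maximal
   compact subgroup SO(p) x SO(2) of the latter, \det D is identically 1, so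
   that psi cannot be a coefficient of one of its own scalar holomorphic
   discrete series; it is one of the restriction from SU(p, 2). *)
Definition series_group (T : hermitian_type) :
    set 'M[R[i]]_(ulsize T + drsize T) :=
  match T with
  | TypeSO2 p => SU R p 2
  | T => hermitian_group T
  end.
Arguments series_group T _ : clear implicits.

Definition borel_mx n := g_sigma_algebraType [set U : set 'M[R[i]]_n | open U].

(* mu restricts to a (left) Haar measure on G, a closed subgroup of GL_n(C). *)
Definition haar n (G : set 'M[R[i]]_n)
    (mu : {measure set (borel_mx n) -> \bar R}) : Prop :=
  [/\ (0 < mu G)%E,
      forall K : set 'M[R[i]]_n, compact K -> K `<=` G -> (mu K < +oo)%E
    & forall (g : 'M[R[i]]_n) (A : set (borel_mx n)), G g ->
        measurable A -> A `<=` G -> mu [set g *m x | x in A] = mu A].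

(* The Haar measure being unique up to a positive factor, it is harmless to
   quantify over all of them. *)
Definition square_integrable n (G : set 'M[R[i]]_n) (W : 'M[R[i]]_n -> R[i])
    : Prop :=
  [/\ measurable_fun (G : set (borel_mx n)) (fun g => complex.Re (W g)),
      measurable_fun (G : set (borel_mx n)) (fun g => complex.Im (W g))
    & forall mu : {measure set (borel_mx n) -> \bar R}, haar G mu ->
        (\int[mu]_(g in G) (Normc.normc (W g) ^+ 2)%:E < +oo)%E].

(* f is locally on X the restriction of a holomorphic function of the matrix
   entries. On a complex submanifold these are the holomorphic functions; on a
   real matrix group they are, in particular, real analytic. *)
Definition holomorphic_on m n (X : set 'M[R[i]]_(m, n))
    (f : 'M[R[i]]_(m, n) -> R[i]) : Prop :=
  forall x, X x -> exists (U : set 'M[R[i]]_(m, n))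
      (F : 'M[R[i]]_(m, n) -> R[i]),
    [/\ open U, U x, forall y, U y -> differentiable F y
      & forall y, U y -> X y -> f y = F y].

(* Holomorphy on a neighbourhood of G in the space of matrices is how the
   smoothness of the extension is expressed. *)
Definition whitney_extension n (G D : set 'M[R[i]]_n)
    (f W : 'M[R[i]]_n -> R[i]) : Prop :=
  holomorphic_on G W /\ forall g, D g -> W g = f g.

Section Blocks.
Variables p q : nat.
Implicit Types (g : 'M[R[i]]_(p + q)) (z : 'M[R[i]]_(p, q)) (l : int).

Definition psi l g : R[i] := (\det (drsubmx (invmx g))) ^ (- l).

Definition automorphy g z : 'M[R[i]]_q := dlsubmx g *m z + drsubmx g.

Definition mobius g z : 'M[R[i]]_(p, q) :=
  (ulsubmx g *m z + ursubmx g) *m invmx (automorphy g z).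

(* The bounded realization of H/K as the orbit of 0. *)
Definition domain (H : set 'M[R[i]]_(p + q)) : set 'M[R[i]]_(p, q) :=
  [set mobius h 0 | h in H].

Definition weight l z : R := complex.Re (\det (1%:M - (z ^t*)%sesqui *m z)) ^ l.

Variables (H : set 'M[R[i]]_(p + q))
          (nu : {measure set (borel_mx (p + q)) -> \bar R}).

(* For nu a Haar measure of H, its image under h |-> mobius h 0 is the
   invariant measure of the domain. Thus an integral over the domain against
   the invariant measure is written as an integral over H. *)
Definition bergman_space l : set ('M[R[i]]_(p, q) -> R[i]) :=
  [set phi | holomorphic_on (domain H) phi /\
    nu.-integrable H (fun h => let z := mobius h 0 in
      (Normc.normc (phi z) ^+ 2 * weight l z)%:E)].

Definition bergman_inner l (phi chi : 'M[R[i]]_(p, q) -> R[i]) : R[i] :=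
  let F h := let z := mobius h 0 in
    phi z * (chi z)^* * (weight l z)%:C in
  Rintegral nu H (fun h => complex.Re (F h)) +i*
  Rintegral nu H (fun h => complex.Im (F h)).

Definition series_rep l g (phi : 'M[R[i]]_(p, q) -> R[i]) z : R[i] :=
  (\det (automorphy (invmx g) z)) ^ (- l) * phi (mobius (invmx g) z).

(* <series_rep l g 1, 1>_l, the inner product being normalized by <1, 1>_l = 1. *)
Definition series_coeff l g : R[i] :=
  bergman_inner l (series_rep l g (cst 1)) (cst 1) /
  bergman_inner l (cst 1) (cst 1).

End Blocks.

(* Holomorphy of an extension, in the representation-theoretic sense: W is on
   the group a finite linear combination of matrix coefficients of scalar
   holomorphic discrete series representations. Membership of the constant 1 in the
   Bergman space says that its parameter is one of the discrete series. *)
Definition series_coeff_span (T : hermitian_type)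
    (W : 'M[R[i]]_(ulsize T + drsize T) -> R[i]) : Prop :=
  exists (s : seq int) (a : int -> R[i]),
  forall nu : {measure set (borel_mx (ulsize T + drsize T)) -> \bar R},
  haar (series_group T) nu ->
  (forall l, l \in s -> bergman_space (series_group T) nu l (cst 1)) /\
  forall g, hermitian_group T g ->
    W g = \sum_(l <- s) a l * series_coeff (series_group T) nu l g.

End HermitianGroups.

#[global] Arguments hermitian_group R T _ : clear implicits.
#[global] Arguments series_group R T _ : clear implicits.
#[global] Arguments series_coeff_span R T W : clear implicits.

(* Main.v *)
Require Import Defs.
From mathcomp Require Import all_boot all_order all_fingroup all_algebra.
From mathcomp Require Import complex.
From mathcomp Require Import cyclic separable cyclotomic ring lra.
From mathcomp Require Import all_classical all_reals all_analysis measurable_realfun.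
Set Implicit Arguments.
Unset Strict Implicit.
Unset Printing Implicit Defensive.
Import Order.TTheory GRing.Theory Num.Theory.
Import numFieldNormedType.Exports.
Local Open Scope classical_set_scope.
Local Open Scope ring_scope.

(* All the groups lie in SU(p, q). Write D for the lower right block of g. The
   relations g* I g = I = g I g* make D invertible with |D^-1| <= 1 entrywise,
   and bound every entry of g by a constant times |det D|. Since psi_l has
   modulus |det D|^-l on the group, the values at the g_j of any n consecutive
   psi_l form a Vandermonde-like invertible system, and only integrability for
   large l remains.

   Integrability needs no structure theory. Cut the box of entries of size <= j
   into cells of side about 1/j: two elements g, h of one cell have g^-1 h in a
   fixed compact set, so left invariance bounds the Haar measure of the box by
   a polynomial in j, and |det D|^-2l beats it on dyadic shells.

   The weight of the Bergman space, pulled back to the group, is |det D|^-2l, so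
   the same bound puts the constant 1 in the space. The matrix coefficient of 1
   is psi_l by a mean value property: det (C z + D)^-l is det D^-l times
   det (1 + Y z)^-l with Y = D^-1 C a strict contraction, a bounded pointwise
   limit of powers of determinants of truncated Neumann series. These are
   polynomial in t under z |-> t z; averaging over roots of unity t, which act
   through the center of the maximal compact subgroup and preserve the Haar
   measure, leaves the value at z = 0, and dominated convergence concludes. *)

Local Notation "A ^*m" := (A ^t*)%sesqui (at level 8, format "A ^*m").

(** * Pseudo-unitary matrices *)

Section Adjoint.
Variable C : numClosedFieldType.

Lemma adjmxM m n p (A : 'M[C]_(m, n)) (B : 'M[C]_(n, p)) :
  (A *m B)^*m = B^*m *m A^*m.
Proof. by rewrite trmx_mul map_mxM. Qed.

Lemma adjmx1 n : (1%:M : 'M[C]_n)^*m = 1%:M.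
Proof. by rewrite trmx1 map_mx1. Qed.

Lemma adjmx_block p q (A : 'M[C]_p) B D (E : 'M[C]_q) :
  (block_mx A B D E)^*m = block_mx A^*m D^*m B^*m E^*m.
Proof. by rewrite tr_block_mx map_block_mx. Qed.

Lemma det_adjmx n (A : 'M[C]_n) : \det A^*m = (\det A)^*.
Proof. by rewrite det_map_mx det_tr. Qed.

Lemma mulmx_adj_diag m n (A : 'M[C]_(m, n)) i :
  (A *m A^*m) i i = \sum_k `|A i k| ^+ 2.
Proof. by rewrite mxE; apply: eq_bigr => k _; rewrite !mxE normCK. Qed.

Lemma adj_mulmx_diag m n (A : 'M[C]_(m, n)) i :
  (A^*m *m A) i i = \sum_k `|A k i| ^+ 2.
Proof. by rewrite mxE; apply: eq_bigr => k _; rewrite !mxE normCK mulrC. Qed.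

Lemma sum_sqr_ge0 (I : finType) (F : I -> C) : 0 <= \sum_i `|F i| ^+ 2.
Proof. by apply: sumr_ge0 => i _; rewrite exprn_ge0. Qed.

Lemma sqr_le_sum (I : finType) (F : I -> C) i : `|F i| ^+ 2 <= \sum_k `|F k| ^+ 2.
Proof.
rewrite (bigD1 i) //= lerDl sumr_ge0 // => k _; exact: exprn_ge0.
Qed.

Lemma mulmx_adj_eq0 n (w : 'rV[C]_n) : (w *m w^*m) 0 0 = 0 -> w = 0.
Proof.
rewrite mulmx_adj_diag => /eqP; rewrite psumr_eq0; last by move=> k _; rewrite exprn_ge0.
move=> /allP w0; apply/rowP => j; rewrite mxE.
by have := w0 j (mem_index_enum _); rewrite expf_eq0 /= normr_eq0 => /eqP.
Qed.

(* A matrix [X] with [X X* = 1 + Y Y*] is invertible: [u X = 0] forces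
   [u u* + (u Y) (u Y)* = 0]. *)
Lemma unitmx_mul_adj n m (X : 'M[C]_n) (Y : 'M[C]_(n, m)) :
  X *m X^*m = 1%:M + Y *m Y^*m -> X \in unitmx.
Proof.
move=> eqX; rewrite -row_free_unit; apply: inj_row_free => u uX0.
apply: mulmx_adj_eq0; apply/eqP; rewrite eq_le; apply/andP; split; last first.
  by rewrite mulmx_adj_diag sum_sqr_ge0.
have : (u *m (X *m X^*m) *m u^*m) 0 0 = 0 by rewrite mulmxA uX0 !mul0mx mxE.
rewrite eqX mulmxDr mulmx1 mulmxDl mxE => /eqP.
rewrite addr_eq0 => /eqP ->; rewrite oppr_le0.
by rewrite !mulmxA -mulmxA -adjmxM mulmx_adj_diag sum_sqr_ge0.
Qed.

Lemma norm_det_le n (M : 'M[C]_n) b :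
  (forall i j, `|M i j| <= b) -> `|\det M| <= n`!%:R * b ^+ n.
Proof.
move=> Mb; apply: le_trans (ler_norm_sum _ _ _) _.
have -> : n`!%:R * b ^+ n = \sum_(s : 'S_n) b ^+ n.
  by rewrite sumr_const card_Sn mulr_natl.
apply: ler_sum => s _; rewrite normrM normrX normrN1 expr1n mul1r normr_prod.
rewrite -[n in b ^+ n]card_ord -prodr_const.
by apply: ler_prod => i _; rewrite normr_ge0 Mb.
Qed.

(* The rows of [X^-1] have norm at most 1, and [X = (\det X) *: \adj X^-1]. *)
Lemma mul_adj_bounds n m (X : 'M[C]_n) (Y : 'M[C]_(n, m)) :
  X *m X^*m = 1%:M + Y *m Y^*m ->
  [/\ forall i j, `|invmx X i j| <= 1,
      1 <= n`!%:R * `|\det X| & forall i j, `|X i j| <= n`!%:R * `|\det X|].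
Proof.
move=> eqX; have Xu := unitmx_mul_adj eqX.
have Eb i j : `|invmx X i j| <= 1.
  rewrite -[1](expr1n _ 2) -(ler_pXn2r (_ : 0 < 2)%N) ?nnegrE ?expr1n //.
  apply: le_trans (sqr_le_sum _ _) _; rewrite -mulmx_adj_diag.
  have : invmx X *m (X *m X^*m) *m (invmx X)^*m = 1%:M.
    by rewrite mulKmx // -adjmxM mulVmx // adjmx1.
  rewrite eqX mulmxDr mulmx1 mulmxDl => /matrixP/(_ i i).
  rewrite mxE [RHS]mxE eqxx mulr1n mulmxA -mulmxA -adjmxM => <-.
  by rewrite lerDl mulmx_adj_diag sum_sqr_ge0.
have d0 : 0 < `|\det X| by rewrite normr_gt0 -unitfE -unitmxE.
split=> // [|i j].
  have := norm_det_le Eb; rewrite expr1n mulr1 det_inv normfV => le_n.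
  by rewrite -[X in X <= _](mulVf (lt0r_neq0 d0)) ler_pM2r.
have -> : X i j = \det X * (\adj (invmx X)) i j.
  by rewrite -{1}[X]invmxK {1}/invmx unitmx_inv Xu det_inv invrK mxE.
rewrite normrM mulrC ler_wpM2r // mxE /cofactor normrM normrX normrN1 expr1n mul1r.
have : `|\det (row' j (col' i (invmx X)))| <= n.-1`!%:R * 1 ^+ n.-1.
  by apply: norm_det_le => a b; rewrite !mxE.
rewrite expr1n mulr1 => /le_trans; apply; rewrite ler_nat.
by case: (n) => // k; rewrite factS leq_pmull.
Qed.

End Adjoint.

(** * Block relations, and bounds in terms of the lower right block *)

Section PseudoUnitary.
Variables (C : numClosedFieldType) (p q : nat).
Implicit Types g h : 'M[C]_(p + q).

(** [sign_mx] is [Ipq] over an arbitrary closed field with conjugation; a member of [SU] is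
    [pseudo_unitary] by unfolding. *)
Definition sign_mx : 'M[C]_(p + q) := block_mx 1%:M 0 0 (- 1%:M).
Definition pseudo_unitary g := g^*m *m sign_mx *m g = sign_mx.

Lemma sign_mxK : sign_mx *m sign_mx = 1%:M.
Proof.
rewrite mulmx_block !mulmx1 !mul0mx !mulmx0 mulmxN mulmx1 opprK.
by rewrite !addr0 !add0r -scalar_mx_block.
Qed.

Lemma adj_sign_mx : sign_mx^*m = sign_mx.
Proof. by rewrite adjmx_block raddfN /= map_mxN !adjmx1 !trmx0 !map_mx0. Qed.

Lemma pseudo_unitary_mulV g : pseudo_unitary g ->
  g *m (sign_mx *m g^*m *m sign_mx) = 1%:M.
Proof. by move=> gU; apply: mulmx1C; rewrite -!mulmxA [_ *m (_ *m g)]mulmxA gU sign_mxK. Qed.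

Lemma pseudo_unitary_unit g : pseudo_unitary g -> g \in unitmx.
Proof. by move/pseudo_unitary_mulV/mulmx1_unit => []. Qed.

Lemma pseudo_unitary_inv g : pseudo_unitary g -> invmx g = sign_mx *m g^*m *m sign_mx.
Proof.
move=> gU; have := pseudo_unitary_mulV gU; move/(congr1 (mulmx (invmx g))).
by rewrite mulKmx ?pseudo_unitary_unit // mulmx1 => ->.
Qed.

Lemma pseudo_unitary_adj g : pseudo_unitary g -> g *m sign_mx *m g^*m = sign_mx.
Proof.
move=> gU; have := pseudo_unitary_mulV gU; move/(congr1 (mulmx^~ sign_mx)).
by rewrite mul1mx -!mulmxA sign_mxK mulmx1 mulmxA.
Qed.

Lemma pseudo_unitaryV g : pseudo_unitary g -> pseudo_unitary (invmx g).
Proof.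
move=> gU; rewrite /pseudo_unitary pseudo_unitary_inv // !adjmxM trmxCK adj_sign_mx.
rewrite -!mulmxA (mulmxA sign_mx sign_mx) sign_mxK mul1mx.
rewrite (mulmxA sign_mx g^*m) (mulmxA g) (mulmxA g).
by rewrite pseudo_unitary_adj // sign_mxK mulmx1.
Qed.

Lemma pseudo_unitaryM g h : pseudo_unitary g -> pseudo_unitary h -> pseudo_unitary (g *m h).
Proof.
move=> gU hU; rewrite /pseudo_unitary adjmxM -!mulmxA (mulmxA sign_mx) (mulmxA g^*m).
by rewrite (mulmxA g^*m) gU mulmxA.
Qed.

Lemma drsubmx_inv g : pseudo_unitary g -> drsubmx (invmx g) = (drsubmx g)^*m.
Proof.
move=> gU; rewrite pseudo_unitary_inv // -[g in g^*m]submxK adjmx_block /sign_mx !mulmx_block.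
by rewrite !block_mxKdr !mul0mx !mulmx0 !add0r mulNmx mul1mx mulmxN mulNmx mulmx1 opprK.
Qed.

(** The first three identities are blocks of g^*m I g = I, the last two of g I g^*m = I. Here [D] is
    the lower left block and [E] the lower right one. *)
Lemma pseudo_unitary_block g : pseudo_unitary g ->
  let A := ulsubmx g in let B := ursubmx g in let D := dlsubmx g in let E := drsubmx g in
  [/\ A^*m *m A = 1%:M + D^*m *m D, E^*m *m E = 1%:M + B^*m *m B,
      A^*m *m B = D^*m *m E, A *m A^*m = 1%:M + B *m B^*m
    & E *m E^*m = 1%:M + D *m D^*m].
Proof.
move=> gU A B D E.
have : g^*m *m sign_mx *m g = sign_mx by [].
rewrite -[g]submxK -/A -/B -/D -/E adjmx_block /sign_mx !mulmx_block.
rewrite !mulmx0 !mulmxN !mulmx1 !addr0 !add0r !mulNmx.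
have subN (n : nat) (X Y : 'M[C]_n) : X - Y = - 1%:M -> Y = 1%:M + X.
  by move=> XY; rewrite -[1%:M]opprK -XY opprB subrK.
move=> /eq_block_mx[/(canRL (subrK _)) -> /(canRL (subrK _)) -> _ /subN ->].
have := pseudo_unitary_adj gU.
rewrite -[g]submxK -/A -/B -/D -/E adjmx_block /sign_mx !mulmx_block.
rewrite !mulmx0 !mulmxN !mulmx1 !addr0 !add0r !mulNmx.
move=> /eq_block_mx[/(canRL (subrK _)) -> _ _ /subN ->].
split=> //; by rewrite ?add0r. 
Qed.

Lemma drsubmx_unit g : pseudo_unitary g -> drsubmx g \in unitmx.
Proof. by case/pseudo_unitary_block => _ _ _ _; exact: unitmx_mul_adj. Qed.

Lemma det_drsubmx_ge g : pseudo_unitary g -> 1 <= q`!%:R * `|\det (drsubmx g)|.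
Proof. by case/pseudo_unitary_block => _ _ _ _ /mul_adj_bounds[]. Qed.

(** The factor q! comes from [mul_adj_bounds] for the lower right block; each passage to an adjacent
    block, first to the off-diagonal ones and then to the upper left one, costs a factor q + 1. *)
Definition entry_cst : nat := ((q.+1 ^ 2) * q`!)%N.

(** Columns of the upper right block and rows of the lower left one are controlled by those of the
    lower right block, and rows of the upper left block by those of the upper right one. *)
Lemma pseudo_unitary_entry_le g i j : pseudo_unitary g ->
  `|g i j| <= entry_cst%:R * `|\det (drsubmx g)|.
Proof.
move=> gU; have [_ eqE' _ eqA eqE] := pseudo_unitary_block gU.
have [_ d1 Eb] := mul_adj_bounds eqE.
set d := q`!%:R * `|_| in d1 Eb.
have d0 : 0 <= d by apply: le_trans d1.
have -> : entry_cst%:R * `|\det (drsubmx g)| = q.+1%:R ^+ 2 * d.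
  by rewrite /entry_cst natrM natrX mulrA.
clearbody d.
have q1 : 1 <= q.+1%:R :> C by rewrite ler1n.
have le_qd : d <= q.+1%:R ^+ 2 * d by rewrite ler_peMl // exprn_ege1.
have sq_le (x b : C) : 0 <= b -> `|x| ^+ 2 <= b ^+ 2 -> `|x| <= b.
  by move=> b0; rewrite ler_pXn2r // nnegrE.
have sumE (F : 'I_q -> C) b : 0 <= b -> (forall k, `|F k| <= b) ->
    \sum_k `|F k| ^+ 2 <= (q.+1%:R * b) ^+ 2.
  move=> b0 Fb; apply: (@le_trans _ _ (\sum_(k < q) b ^+ 2)).
    by apply: ler_sum => k _; rewrite lerXn2r // ?nnegrE // Fb.
  rewrite sumr_const card_ord exprMn -[_ *+ q]mulr_natl ler_wpM2r ?exprn_ge0 //.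
  by rewrite -natrX ler_nat (leq_trans (leqnSn q)) // leq_pmulr.
have Bb i' j' : `|ursubmx g i' j'| <= q.+1%:R * d.
  apply: sq_le; first by rewrite mulr_ge0.
  apply: le_trans (sqr_le_sum (fun i => ursubmx g i j') i') _.
  apply: le_trans (sumE (fun i => drsubmx g i j') _ d0 (Eb^~ j')).
  by rewrite -!adj_mulmx_diag eqE' [leRHS]mxE lerDr mxE eqxx.
have Cb i' j' : `|dlsubmx g i' j'| <= q.+1%:R * d.
  apply: sq_le; first by rewrite mulr_ge0.
  apply: le_trans (sqr_le_sum (dlsubmx g i') j') _.
  apply: le_trans (sumE (drsubmx g i') _ d0 (Eb i')).
  by rewrite -!mulmx_adj_diag eqE [leRHS]mxE lerDr mxE eqxx.
have Ab i' j' : `|ulsubmx g i' j'| <= q.+1%:R ^+ 2 * d.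
  apply: sq_le; first by rewrite mulr_ge0 // exprn_ge0.
  apply: le_trans (sqr_le_sum (ulsubmx g i') j') _.
  rewrite -mulmx_adj_diag eqA mxE mulmx_adj_diag [X in X + _]mxE eqxx mulr1n.
  (* Since d >= 1, the summand 1 is absorbed in d^2; what remains is 1 + q (q + 1)^2 <= (q +
     1)^4. *)
  apply: (@le_trans _ _ (d ^+ 2 + \sum_(k < q) (q.+1%:R * d) ^+ 2)).
    apply: lerD; first by rewrite exprn_ege1.
    by apply: ler_sum => k _; rewrite lerXn2r // ?nnegrE ?mulr_ge0 // Bb.
  rewrite sumr_const card_ord !exprMn -[_ *+ q]mulr_natl mulrA -{1}[d ^+ 2]mul1r -mulrDl.
  rewrite ler_wpM2r ?exprn_ge0 // -!natrX -?natrM nat1r ler_nat -add1n.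
  apply: (@leq_trans (q.+1 * q.+1 ^ 2)); first by rewrite mulSn leq_add2r expn_gt0.
  by rewrite leq_mul // leq_pmulr.
have le1 : q.+1%:R * d <= q.+1%:R ^+ 2 * d.
  by rewrite ler_wpM2r // expr2 ler_peMl // (le_trans ler01).
rewrite -[g]submxK; case: (split_ordP i) => i' ->; case: (split_ordP j) => j' ->.
- by rewrite block_mxEul.
- by rewrite block_mxEur (le_trans (Bb _ _)).
- by rewrite block_mxEdl (le_trans (Cb _ _)).
- by rewrite block_mxEdr (le_trans (Eb _ _)).
Qed.

(** The image of the origin under the Moebius action of g, see [mobius_0]. *)
Definition mobius0 g : 'M[C]_(p, q) := ursubmx g *m invmx (drsubmx g).

(** Substitute B^*m B = E^*m E - 1, with B and E the right-hand blocks. Taking determinants gives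
    |\det E|^-2, whence [weight_mobius0]. *)
Lemma adj_mobius0 g : pseudo_unitary g ->
  1%:M - (mobius0 g)^*m *m mobius0 g = (invmx (drsubmx g))^*m *m invmx (drsubmx g).
Proof.
move=> gU; set z := mobius0 g; have [_ eqE _ _ _] := pseudo_unitary_block gU.
have Eu := drsubmx_unit gU.
have -> : z^*m *m z = (invmx (drsubmx g))^*m *m ((drsubmx g)^*m *m drsubmx g - 1%:M)
     *m invmx (drsubmx g).
  by rewrite eqE [1%:M + _]addrC addrK /z /mobius0 adjmxM !mulmxA.
rewrite mulmxBr mulmx1 mulmxBl !mulmxA -adjmxM mulmxV // adjmx1 mul1mx mulmxV //.
by rewrite opprB addrC subrK.
Qed.

(* [z = B D^-1 = (A^-1)* C*], whence [z z* = 1 - (A^-1)* A^-1]. *)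
Lemma mobius0_contract g (y : 'rV[C]_p) : pseudo_unitary g ->
  \sum_j `|(y *m mobius0 g) 0 j| ^+ 2 <= \sum_j `|y 0 j| ^+ 2.
Proof.
move=> gU; set z := mobius0 g; have [eqA _ eqAB eqA' _] := pseudo_unitary_block gU.
have Eu := drsubmx_unit gU; have Au := unitmx_mul_adj eqA'.
set X := invmx (ulsubmx g).
have Xz : z = X^*m *m (dlsubmx g)^*m.
  rewrite /z /mobius0 -[ursubmx g]mul1mx -[X in X *m _ *m _]adjmx1 -(mulmxV Au) adjmxM -!mulmxA.
  by rewrite (mulmxA (ulsubmx g)^*m) eqAB -!mulmxA mulmxV // mulmx1.
have zz : z *m z^*m = 1%:M - X^*m *m X.
  rewrite Xz adjmxM !trmxCK !mulmxA -(mulmxA X^*m).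
  have -> : (dlsubmx g)^*m *m dlsubmx g = (ulsubmx g)^*m *m ulsubmx g - 1%:M.
    by rewrite eqA [1%:M + _]addrC addrK.
  rewrite mulmxBr mulmx1 mulmxBl !mulmxA -adjmxM mulmxV // adjmx1 mul1mx mulmxV //.
rewrite -!mulmx_adj_diag adjmxM mulmxA -(mulmxA y) zz mulmxBr mulmx1 mulmxBl mxE.
have -> : y *m (X^*m *m X) *m y^*m = (y *m X^*m) *m (y *m X^*m)^*m.
  by rewrite adjmxM trmxCK !mulmxA.
by rewrite gerDl mxE oppr_le0 mulmx_adj_diag sum_sqr_ge0.
Qed.
End PseudoUnitary.

(** * Polynomial functions and their means over roots of unity *)

Section PolynomialFunctions.
Variable C : idomainType.

(** The degree bound d dictates how many roots of unity an average needs. *)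
Definition polyfun d (f : C -> C) :=
  exists2 P : {poly C}, (size P <= d.+1)%N & forall t, f t = P.[t].

Lemma polyfun_sum I (s : seq I) d (F : I -> C -> C) :
  (forall i, polyfun d (F i)) -> polyfun d (fun t => \sum_(i <- s) F i t).
Proof.
move=> Fd; elim: s => [|i s [P sP eP]].
  by exists 0 => [|t]; rewrite ?size_poly0 // big_nil horner0.
have [Q sQ eQ] := Fd i; exists (Q + P) => [|t].
  by rewrite (leq_trans (size_polyD _ _)) // geq_max sQ.
by rewrite big_cons hornerD eQ eP.
Qed.

Lemma polyfunM d e f g : polyfun d f -> polyfun e g -> polyfun (d + e) (fun t => f t * g t).
Proof.
move=> [P sP eP] [Q sQ eQ]; exists (P * Q) => [|t]; last by rewrite hornerM eP eQ.
rewrite (leq_trans (size_polyMleq _ _)) //.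
by have := leq_add sP sQ; rewrite addSn addnS; case: (_ + _)%N.
Qed.

Lemma polyfun_prod I (s : seq I) d (F : I -> C -> C) :
  (forall i, polyfun d (F i)) -> polyfun (size s * d) (fun t => \prod_(i <- s) F i t).
Proof.
move=> Fd; elim: s => [|i s ihs].
  by exists 1 => [|t]; rewrite ?size_poly1 // big_nil hornerC.
have [P sP eP] := polyfunM (Fd i) ihs; exists P => // t.
by rewrite big_cons -eP.
Qed.

Lemma polyfun_cst d c : polyfun d (fun=> c).
Proof. by exists c%:P => [|t]; rewrite ?hornerC // size_polyC; case: eqP. Qed.

Lemma polyfun_det n d (M : C -> 'M[C]_n) :
  (forall i j, polyfun d (fun t => M t i j)) -> polyfun (n * d) (fun t => \det (M t)).
Proof.
move=> Md; apply: polyfun_sum => s; rewrite -[(n * d)%N]add0n.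
apply: polyfunM (polyfun_cst _ _) _.
have := polyfun_prod (index_enum 'I_n) (fun i => Md i (s i)).
by rewrite -[index_enum _]enumT size_enum_ord.
Qed.

Lemma polyfun_exp d f l : polyfun d f -> polyfun (l * d) (fun t => f t ^+ l).
Proof.
move=> fd; elim: l => [|l ihl]; first exact: polyfun_cst.
have [P sP eP] := polyfunM fd ihl; exists P => // t.
by rewrite exprS -eP.
Qed.

Lemma sum_prim_root N (w : C) k : N.-primitive_root w -> (0 < k < N)%N ->
  \sum_(j < N) (w ^+ j) ^+ k = 0.
Proof.
move=> wN /andP[k0 kN]; have wk1 : w ^+ k != 1.
  by rewrite -(prim_order_dvd wN) gtnNdvd.
have wk0 : w ^+ k - 1 != 0 by rewrite subr_eq0.
apply: (mulfI wk0); rewrite mulr0.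
under eq_bigr do rewrite exprAC.
by rewrite -subrX1 exprAC (prim_expr_order wN) expr1n subrr.
Qed.

(** Expand in powers of t: [sum_prim_root] cancels every exponent k with 0 < k < N, so only the
    constant coefficient survives. *)
Lemma polyfun_mean N (w : C) d f : N.-primitive_root w -> (d < N)%N -> polyfun d f ->
  \sum_(j < N) f (w ^+ j) = N%:R * f 0.
Proof.
move=> wN dN [P sP eP]; under eq_bigr do rewrite eP (horner_coef_wide _ sP).
rewrite exchange_big big_ord_recl /= [X in _ + X]big1 => [|k _]; last first.
  rewrite -mulr_sumr (sum_prim_root wN) ?mulr0 //= /bump /= add1n (leq_ltn_trans _ dN) //.
rewrite eP horner_coef0 addr0; under eq_bigr do rewrite mulr1.
by rewrite sumr_const card_ord mulr_natl.
Qed.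

End PolynomialFunctions.

(** * Truncated Neumann series *)

Section NeumannSeries.
Variables (C : numClosedFieldType) (n : nat).

(** Partial sum of the series for (1 + M)^-1. Unlike the inverse it is polynomial in M, so that it
    can be averaged exactly. *)
Definition neumann K (M : 'M[C]_n) : 'M[C]_n := \sum_(k < K) (- M) ^+ k.

Lemma det_neumann K (M : 'M[C]_n) :
  \det (neumann K M) * \det (1%:M + M) = \det (1%:M - (- M) ^+ K).
Proof.
rewrite mulrC -det_mulmx; congr (\det _).
have eqS : (- M) ^+ K - 1 = (- M - 1) * neumann K M := subrX1 (- M) K.
have eqM : (1%:M + M) *m neumann K M = - ((- M - 1) * neumann K M).
  by rewrite -mulNr opprD !opprK addrC.
by rewrite eqM -eqS opprB.
Qed.

Lemma expmxZ t (M : 'M[C]_n) k : (t *: M) ^+ k = t ^+ k *: M ^+ k.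
Proof.
elim: k => [|k ihk]; first by rewrite !expr0 scale1r.
rewrite !exprS ihk -[LHS]/((t *: M) *m (t ^+ k *: M ^+ k)) -scalemxAr -scalemxAl.
by rewrite scalerA mulrC.
Qed.

Lemma polyfun_neumann K (M : 'M[C]_n) :
  polyfun (n * K) (fun t => \det (neumann K (t *: M))).
Proof.
apply: polyfun_det => i j.
exists (\poly_(k < K) ((- M) ^+ k) i j) => [|t].
  exact: leq_trans (size_poly _ _) (leqnSn _).
rewrite /neumann horner_poly summxE; apply: eq_bigr => k _.
by rewrite -scalerN expmxZ mxE mulrC.
Qed.

(** The successor excludes the empty sum [neumann 0 M], which is 0; every other truncation has
    determinant 1 at the center z = 0. *)
Lemma neumann0 K : neumann K.+1 0 = 1%:M.
Proof.
rewrite /neumann big_ord_recl big1 => [|k _]; last by rewrite oppr0 expr0n.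
by rewrite addr0.
Qed.

Section Contraction.
Variables (M : 'M[C]_n) (rho : C).
Hypothesis rho0 : 0 <= rho.
Hypothesis Mrho : forall w : 'rV[C]_n,
  \sum_j `|(w *m M) 0 j| ^+ 2 <= rho * \sum_j `|w 0 j| ^+ 2.

(** [rho] bounds the squared operator norm on row vectors, hence the square root; row i of a power
    is the image of ['e_i]. *)
Lemma contractX_entry k i j : `|(M ^+ k) i j| <= sqrtC rho ^+ k.
Proof.
have pw (w : 'rV[C]_n) : \sum_j `|(w *m M ^+ k) 0 j| ^+ 2 <= rho ^+ k * \sum_j `|w 0 j| ^+ 2.
  elim: k w => [|k ihk] w; first by rewrite mulmx1 mul1r.
  rewrite exprS [_ * _]/(mulmx _ _) mulmxA (le_trans (ihk _)) // exprSr -mulrA.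
  by rewrite ler_wpM2l // exprn_ge0.
have := pw 'e_i; rewrite -rowE => H.
rewrite -(ler_pXn2r (_ : 0 < 2)%N) ?nnegrE ?exprn_ge0 ?sqrtC_ge0 //.
rewrite exprAC sqrtCK; apply: le_trans (le_trans H _).
  by have := sqr_le_sum (fun j => (row i (M ^+ k)) 0 j) j; rewrite mxE.
rewrite -[leRHS]mulr1 ler_wpM2l ?exprn_ge0 // (bigD1 i) //= mxE !eqxx normr1 expr1n.
rewrite big1 ?addr0 // => l /negPf li; rewrite mxE li normr0 expr0n //.
Qed.

(** A geometric series; the bound does not depend on K and thus provides domination later. *)
Lemma neumann_entry K i j : rho < 1 -> `|neumann K M i j| <= (1 - sqrtC rho)^-1.
Proof.
move=> rho1; have r1 : sqrtC rho < 1 by rewrite -[ltRHS]sqrtC1 ltr_sqrtC ?nnegrE.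
rewrite /neumann summxE; apply: le_trans (ler_norm_sum _ _ _) _.
apply: (@le_trans _ _ (\sum_(k < K) sqrtC rho ^+ k)).
  apply: ler_sum => k _; rewrite -scaleN1r expmxZ mxE normrM normrX normrN1 expr1n mul1r.
  exact: contractX_entry.
have r1' : 0 < 1 - sqrtC rho by rewrite subr_gt0.
rewrite -(ler_pM2l r1') divff ?gt_eqF // -[X in X * _]opprB mulNr -subrX1 opprB.
by rewrite gerBl exprn_ge0 // sqrtC_ge0.
Qed.
End Contraction.
End NeumannSeries.

(** * Strict contraction by the quotient of the two lower blocks *)

Section RatioContraction.
Variable C : numClosedFieldType.

(** Each of the q entries is a sum of q products, each at most M times the norm of v; this crude
    count gives q^3. *)
Lemma mulmx_row_le q (v : 'rV[C]_q) (E : 'M[C]_q) M : (forall i j, `|E i j| <= M) ->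
  \sum_j `|(v *m E) 0 j| ^+ 2 <= q%:R ^+ 3 * M ^+ 2 * \sum_j `|v 0 j| ^+ 2.
Proof.
move=> EM; have N0 := sum_sqr_ge0 (v 0); set N := \sum_j `|v 0 j| ^+ 2.
have -> : q%:R ^+ 3 * M ^+ 2 * N = (q%:R * M * sqrtC N) ^+ 2 *+ #|'I_q|.
  by rewrite card_ord -[_ *+ q]mulr_natl !exprMn sqrtCK; ring.
rewrite -sumr_const.
apply: ler_sum => j _; have M0 : 0 <= M := le_trans (normr_ge0 _) (EM j j).
rewrite lerXn2r ?nnegrE ?mulr_ge0 ?sqrtC_ge0 //.
rewrite mxE (le_trans (ler_norm_sum _ _ _)) //.
rewrite -mulrA mulr_natl -[X in _ *+ X]card_ord -sumr_const.
apply: ler_sum => i _; rewrite normrM mulrC; apply: ler_pM => //.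
by rewrite -(ler_pXn2r (_ : 0 < 2)%N) ?nnegrE ?sqrtC_ge0 // sqrtCK (sqr_le_sum (v 0)).
Qed.

(** With Y = E^-1 D, the relation E E^*m = 1 + D D^*m gives |w Y|^2 = |w|^2 - |w E^-1|^2. Strictness
    comes from |w|^2 <= t |w E^-1|^2, obtained by writing w = (w E^-1) E. *)
Lemma ratio_contract p q (g : 'M[C]_(p + q)) : pseudo_unitary g ->
  exists2 rho : C, 0 <= rho < 1 & forall w : 'rV[C]_q,
    \sum_j `|(w *m (invmx (drsubmx g) *m dlsubmx g)) 0 j| ^+ 2 <= rho * \sum_j `|w 0 j| ^+ 2.
Proof.
move=> gU; have [_ _ _ _ eqE] := pseudo_unitary_block gU.
have Eu := drsubmx_unit gU; set E := drsubmx g in eqE Eu *; set D := dlsubmx g in eqE *.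
pose M := \sum_i \sum_j `|E i j|.
have EM i j : `|E i j| <= M.
  rewrite /M (bigD1 i) //= (bigD1 j) //= -addrA lerDl addr_ge0 ?sumr_ge0 // => k _.
  exact: sumr_ge0.
have M0 : 0 <= M by apply: sumr_ge0 => i _; apply: sumr_ge0.
(* The summand 1 ensures t >= 1, so that 1 - t^-1 lies in [0, 1). *)
pose t := q%:R ^+ 3 * M ^+ 2 + 1.
have t1 : 1 <= t by rewrite lerDr mulr_ge0 ?exprn_ge0.
have t0 : 0 < t := lt_le_trans ltr01 t1.
exists (1 - t^-1) => [|w].
  by rewrite subr_ge0 invf_le1 // t1 gtrBl invr_gt0.
have YY : (invmx E *m D) *m (invmx E *m D)^*m = 1%:M - invmx E *m (invmx E)^*m.
  rewrite adjmxM -mulmxA (mulmxA D).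
  have -> : D *m D^*m = E *m E^*m - 1%:M by rewrite eqE [1%:M + _]addrC addrK.
  by rewrite mulmxBl mulmxBr mul1mx -mulmxA mulKmx // -adjmxM mulVmx // adjmx1.
have -> : \sum_j `|(w *m (invmx E *m D)) 0 j| ^+ 2 =
    \sum_j `|w 0 j| ^+ 2 - \sum_j `|(w *m invmx E) 0 j| ^+ 2.
  have -> (X : 'M[C]_(q, p)) : \sum_j `|(w *m X) 0 j| ^+ 2 = (w *m (X *m X^*m) *m w^*m) 0 0.
    by rewrite -mulmx_adj_diag (adjmxM w) !mulmxA.
  rewrite YY mulmxBr mulmx1 mulmxBl mxE [X in _ + X]mxE mulmx_adj_diag; congr (_ - _).
  by rewrite -mulmx_adj_diag (adjmxM w) !mulmxA.
rewrite mulrBl mul1r lerB // -(ler_pM2l t0) mulrA divff ?gt_eqF // mul1r.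
rewrite -{1}[w](mulmxKV Eu); apply: le_trans (mulmx_row_le _ EM) _.
by rewrite ler_wpM2r ?sum_sqr_ge0 // lerDl.
Qed.
End RatioContraction.

(** * Topology of complex matrices and of the classical groups *)

Section EntrywiseContinuity.
Variables (K : numFieldType) (T : topologicalType) (x : T).

Lemma continuous_at_cst (c : K) : continuous_at x (fun=> c).
Proof. exact: cvg_cst. Qed.

Lemma continuous_atD (f g : T -> K) : continuous_at x f -> continuous_at x g ->
  continuous_at x (fun y => f y + g y).
Proof. by move=> fc gc; exact: (cvgD fc gc). Qed.

Lemma continuous_atM (f g : T -> K) : continuous_at x f -> continuous_at x g ->
  continuous_at x (fun y => f y * g y).
Proof. by move=> fc gc; exact: (cvgM fc gc). Qed.

Lemma continuous_at_sum I (s : seq I) (F : I -> T -> K) :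
  (forall i, continuous_at x (F i)) ->
  continuous_at x (fun y => \sum_(i <- s) F i y).
Proof.
move=> Fc; elim: s => [|i s ihs].
  by under eq_fun do rewrite big_nil; exact: cvg_cst.
by under eq_fun do rewrite big_cons; exact: (continuous_atD (Fc i)).
Qed.

Lemma continuous_at_prod I (s : seq I) (F : I -> T -> K) :
  (forall i, continuous_at x (F i)) ->
  continuous_at x (fun y => \prod_(i <- s) F i y).
Proof.
move=> Fc; elim: s => [|i s ihs].
  by under eq_fun do rewrite big_nil; exact: cvg_cst.
by under eq_fun do rewrite big_cons; exact: (continuous_atM (Fc i)).
Qed.

Lemma continuous_at_exp (f : T -> K) k :
  continuous_at x f -> continuous_at x (fun y => f y ^+ k).
Proof.
move=> fc; elim: k => [|k ihk]; first by under eq_fun do rewrite expr0; exact: cvg_cst.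
by under eq_fun do rewrite exprS; exact: continuous_atM.
Qed.

(** Entrywise continuity passes easily through products and determinants; [continuous_mx_at]
    converts it to the matrix topology. *)
Definition mx_continuous_at m n (M : T -> 'M[K]_(m, n)) :=
  forall i j, continuous_at x (fun y => M y i j).

Lemma mx_continuous_at_cst m n (M : 'M[K]_(m, n)) : mx_continuous_at (fun=> M).
Proof. by move=> i j; exact: cvg_cst. Qed.

Lemma mx_continuous_atZ m n (c : T -> K) (M : T -> 'M[K]_(m, n)) :
  continuous_at x c -> mx_continuous_at M -> mx_continuous_at (fun y => c y *: M y).
Proof. by move=> cc Mc i j; under eq_fun do rewrite mxE; exact: continuous_atM. Qed.

Lemma mx_continuous_atM m n p (M : T -> 'M[K]_(m, n)) (N : T -> 'M[K]_(n, p)) :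
  mx_continuous_at M -> mx_continuous_at N -> mx_continuous_at (fun y => M y *m N y).
Proof.
move=> Mc Nc i j; under eq_fun do rewrite mxE.
by apply: continuous_at_sum => k; apply: continuous_atM; [exact: Mc|exact: Nc].
Qed.

Lemma continuous_at_det n (M : T -> 'M[K]_n) :
  mx_continuous_at M -> continuous_at x (fun y => \det (M y)).
Proof.
move=> Mc; apply: continuous_at_sum => s; apply: continuous_atM; first exact: cvg_cst.
by apply: continuous_at_prod => i; exact: Mc.
Qed.

Lemma mx_continuous_at_adj n (M : T -> 'M[K]_n) :
  mx_continuous_at M -> mx_continuous_at (fun y => \adj (M y)).
Proof.
move=> Mc i j; under eq_fun do rewrite mxE; apply: continuous_atM; first exact: cvg_cst.
by apply: continuous_at_det => k l; under eq_fun do rewrite !mxE; exact: Mc.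
Qed.

Lemma mx_continuous_at_sum I (s : seq I) m n (F : I -> T -> 'M[K]_(m, n)) :
  (forall i, mx_continuous_at (F i)) ->
  mx_continuous_at (fun y => \sum_(i <- s) F i y).
Proof.
move=> Fc i j; under eq_fun do rewrite summxE.
by apply: continuous_at_sum => k; exact: Fc.
Qed.

End EntrywiseContinuity.

Lemma continuous_mx_at (T : topologicalType) (U : ptopologicalType) m n
    (M : T -> 'M[U]_(m, n)) (x : T) :
  (forall i j, continuous_at x (fun y => M y i j)) -> continuous_at x M.
Proof.
move=> Mc A [P MP PA].
have PM i j : \forall y \near x, P i j (M y i j) by exact: (Mc i j _ (MP i j)).
have : \forall y \near x, forall ij : 'I_m * 'I_n, P ij.1 ij.2 (M y ij.1 ij.2).
  by apply: filter_forall => -[i j]; exact: PM.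
by apply: filterS => y Py; apply: PA => i j; exact: (Py (i, j)).
Qed.

(** * Topology of the complex numbers *)

Section ComplexTopology.
Variable R : realType.
Local Notation C := R[i].

(** Balls of [R[i]] have radii in [R[i]]; real radii suffice. *)
Lemma nbhs_complexP (x : C) (A : set C) :
  (exists2 e : R, 0 < e & forall y, `|x - y| < e%:C%C -> A y) -> nbhs x A.
Proof.
move=> [e e0 eA]; apply/nbhs_ballP; exists e%:C%C => /=; first by rewrite ltcR.
by move=> y; exact: eA.
Qed.

Lemma ReB (x y : C) : complex.Re (x - y) = complex.Re x - complex.Re y.
Proof. by case: x y => [a b] [c d]. Qed.

Lemma ImB (x y : C) : complex.Im (x - y) = complex.Im x - complex.Im y.
Proof. by case: x y => [a b] [c d]. Qed.

Lemma normRe (x : C) : (`|complex.Re x|)%:C%C <= `|x|.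
Proof.
rewrite normc_def lecR -sqrtr_sqr ler_sqrt ?addr_ge0 ?sqr_ge0 //.
by rewrite lerDl sqr_ge0.
Qed.

Lemma normIm (x : C) : (`|complex.Im x|)%:C%C <= `|x|.
Proof.
rewrite normc_def lecR -sqrtr_sqr ler_sqrt ?addr_ge0 ?sqr_ge0 //.
by rewrite lerDr sqr_ge0.
Qed.

Lemma Re_continuous : continuous (@complex.Re R).
Proof.
move=> x; apply/(@cvgrPdist_lt _ R^o C (nbhs x) (nbhs_filter x)) => e e0.
apply: nbhs_complexP; exists e => // y xy.
by rewrite -ltcR -ReB (le_lt_trans (normRe _)).
Qed.

Lemma Im_continuous : continuous (@complex.Im R).
Proof.
move=> x; apply/(@cvgrPdist_lt _ R^o C (nbhs x) (nbhs_filter x)) => e e0.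
apply: nbhs_complexP; exists e => // y xy.
by rewrite -ltcR -ImB (le_lt_trans (normIm _)).
Qed.

Lemma conjC_continuous : continuous (@Num.conj C).
Proof.
move=> x; apply/(@cvgrPdist_lt _ C^o C (nbhs x) (nbhs_filter x)) => e e0.
apply/nbhs_ballP; exists e => // y.
by rewrite /ball /= -rmorphB norm_conjC.
Qed.

Lemma Complex_continuous : continuous (fun p : R * R => (p.1 +i* p.2)%C).
Proof.
move=> [a b]; apply/(@cvgrPdist_lt _ C^o _ (nbhs (a, b)) (nbhs_filter _)) => e e0.
have [d eqe] : exists d : R, e = d%:C%C by exists (complex.Re e); rewrite RRe_real // gtr0_real.
have d0 : 0 < d by rewrite -ltcR -eqe.
have near1 : \forall p \near (a, b), `|a - p.1| < d / 2.
  apply: (iffLR (@cvgrPdist_lt _ R^o _ (nbhs (a, b)) (nbhs_filter _) fst a)); last exact: divr_gt0.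
  exact: cvg_fst.
have near2 : \forall p \near (a, b), `|b - p.2| < d / 2.
  apply: (iffLR (@cvgrPdist_lt _ R^o _ (nbhs (a, b)) (nbhs_filter _) snd b)); last exact: divr_gt0.
  exact: cvg_snd.
near=> p; rewrite /= eqe.
have -> : (a +i* b)%C - (p.1 +i* p.2)%C = (a - p.1)%:C%C + 'i%C * (b - p.2)%:C%C.
  by apply/eqP; rewrite eq_complex /= !mul0r !mul1r !subr0 !add0r !addr0 !eqxx.
apply: le_lt_trans (ler_normD _ _) _.
rewrite normrM normc_def /= [`|'i%C|]normc_def /= expr0n expr1n add0r sqrtr1 mul1r.
rewrite normc_def /= expr0n !addr0 !sqrtr_sqr -rmorphD ltcR [ltRHS]splitr.
by apply: ltrD; near: p.
Unshelve. all: by end_near.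
Qed.

(** The box is the image under [vec_mx] of a power of a compact square in the complex plane. *)
Lemma compact_mx_box m n (b : R) :
  compact [set M : 'M[C]_(m, n) | forall i j,
    `|complex.Re (M i j)| <= b /\ `|complex.Im (M i j)| <= b].
Proof.
pose B : set C := (fun p : R * R => (p.1 +i* p.2)%C) @` (`[- b, b]%classic `*` `[- b, b]%classic).
have cB : compact B.
  apply: continuous_compact; first exact/continuous_subspaceT/Complex_continuous.
  by apply: compact_setX; exact: segment_compact.
have cBB := @rV_compact C (m * n) (fun=> B) (fun=> cB).
rewrite (_ : mkset _ = vec_mx @` [set v : 'rV[C]_(m * n) | forall i, B (v ord0 i)]).
  apply: continuous_compact cBB; apply: continuous_subspaceT => v.
  apply: continuous_mx_at => i j; under eq_fun do rewrite mxE.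
  exact: coord_continuous.
apply/seteqP; split=> [M Mb|_ [v vB <-] i j].
  exists (mxvec M); last exact: mxvecK.
  move=> k; case/mxvec_indexP: k => i j; rewrite mxvecE.
  exists (complex.Re (M i j), complex.Im (M i j)); last by case: (M i j).
  by have [] := Mb i j; rewrite !ler_norml /= !in_itv.
rewrite mxE; case: (vB (mxvec_index i j)) => -[x y] /= [xb yb] <-.
by move: xb yb; rewrite !in_itv !ler_norml.
Qed.
End ComplexTopology.

(** * Closedness and group structure of the classical groups *)

Section ClassicalGroups.
Variable R : realType.
Local Notation C := R[i].

Lemma continuous_at_coord m n (x : 'M[C]_(m, n)) i j :
  continuous_at x (fun M : 'M[C]_(m, n) => M i j).
Proof. exact: coord_continuous. Qed.

Lemma mx_continuous_at_adjmx (T : topologicalType) (x : T) m n (M : T -> 'M[C]_(m, n)) :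
  mx_continuous_at x M -> mx_continuous_at x (fun y => (M y)^*m).
Proof.
move=> Mc i j; under eq_fun do rewrite !mxE.
by apply: (@continuous_comp _ _ _ (fun y => M y j i)); [exact: Mc|exact: conjC_continuous].
Qed.

Lemma closed_level (n : nat) (f : 'M[C]_n -> C) c :
  (forall x, continuous_at x f) -> closed [set x | f x = c].
Proof.
move=> fc; apply: (@preimage_closed _ _ f [set c]) => [x _|]; first exact: fc.
apply: accessible_closed_set1; apply: hausdorff_accessible.
exact: (@norm_hausdorff C C^o).
Qed.

Lemma closed_mx_level (n m k : nat) (f : 'M[C]_n -> 'M[C]_(m, k)) c :
  (forall x, mx_continuous_at x f) -> closed [set x | f x = c].
Proof.
move=> fc; rewrite (_ : mkset _ = \bigcap_i \bigcap_j [set x | f x i j = c i j]).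
  apply: closed_bigI => i _; apply: closed_bigI => j _; apply: closed_level => x.
  exact: fc.
apply/seteqP; split=> [x /= fx i _ j _ /=|x H]; first by rewrite fx.
by apply/matrixP => i j; exact: (H i I j I).
Qed.

Lemma closed_form (n : nat) (J : 'M[C]_n) (f : 'M[C]_n -> 'M[C]_n) :
  (forall x, mx_continuous_at x f) -> closed [set x | f x *m J *m x = J].
Proof.
move=> fc; apply: closed_mx_level => x; apply: mx_continuous_atM.
  by apply: mx_continuous_atM => //; exact: mx_continuous_at_cst.
by move=> i j; exact: continuous_at_coord.
Qed.

Lemma closed_SU p q : closed (SU R p q).
Proof.
apply: closedI.
  by apply: closed_form => x; apply: mx_continuous_at_adjmx => i j; exact: continuous_at_coord.
by apply: closed_level => x; apply: continuous_at_det => i j; exact: continuous_at_coord.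
Qed.

Lemma closed_trmx_form n (J : 'M[C]_n) : closed [set g : 'M[C]_n | g^T *m J *m g = J].
Proof.
apply: closed_form => x i j; under eq_fun do rewrite mxE.
exact: continuous_at_coord.
Qed.

Lemma closed_SO p q : closed (SO R p q).
Proof.
rewrite (_ : SO R p q = SU R p q `&`
    \bigcap_i \bigcap_j [set g : 'M[C]_(p + q) | complex.Im (g i j) = 0]).
  apply: closedI; first exact: closed_SU.
  apply: closed_bigI => i _; apply: closed_bigI => j _.
  apply: (@preimage_closed _ _ (fun g : 'M[C]_(p + q) => complex.Im (g i j)) [set 0]).
    move=> x _; apply: (@continuous_comp _ _ _ (fun g : 'M[C]_(p + q) => g i j)).
      exact: continuous_at_coord.
    exact: Im_continuous.
  exact: closed_eq.
congr (_ `&` _); apply/seteqP; split=> [x xR i _ j _|x xR i j]; first exact: xR.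
exact: (xR i I j I).
Qed.

Lemma continuous_mulmx n m k (A : 'M[C]_(m, n)) :
  continuous (mulmx A : 'M[C]_(n, k) -> 'M[C]_(m, k)).
Proof.
move=> x; apply: continuous_mx_at; apply: mx_continuous_atM.
  exact: mx_continuous_at_cst.
by move=> i j; exact: continuous_at_coord.
Qed.

(** The one-step subgroup criterion: for a nonempty set of invertible matrices it yields 1, inverses
    and products. *)
Definition ldiv_closed n (G : set 'M[C]_n) :=
  forall g h, G g -> G h -> G (invmx g *m h).

Lemma SU_pseudo_unitary p q g : SU R p q g -> pseudo_unitary g.
Proof. by case. Qed.

Lemma SU_ldiv p q : ldiv_closed (SU R p q).
Proof.
move=> g h gG hG; split; last first.
  by rewrite det_mulmx det_inv gG.2 hG.2 invr1 mulr1.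
by apply: pseudo_unitaryM; [apply: pseudo_unitaryV|]; exact: SU_pseudo_unitary.
Qed.

Lemma form_ldiv n (J : 'M[C]_n) : 
  forall g h, g \in unitmx -> g^T *m J *m g = J -> h^T *m J *m h = J ->
   (invmx g *m h)^T *m J *m (invmx g *m h) = J.
Proof.
move=> g h gu gJ hJ.
have gJ' : (invmx g)^T *m J *m invmx g = J.
  by rewrite -{1}gJ trmx_inv !mulmxA mulVmx ?unitmx_tr // mul1mx mulmxK.
by rewrite trmx_mul -!mulmxA (mulmxA J) (mulmxA (invmx g)^T) (mulmxA _ J) gJ' mulmxA.
Qed.

Lemma Sp_ldiv m : ldiv_closed (Sp R m).
Proof.
move=> g h [gG gJ] [hG hJ]; split; first exact: SU_ldiv.
by apply: form_ldiv => //; exact/pseudo_unitary_unit/SU_pseudo_unitary.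
Qed.

Lemma SOstar_ldiv m : ldiv_closed (SOstar R m).
Proof.
move=> g h [gG gJ] [hG hJ]; split; first exact: SU_ldiv.
by apply: form_ldiv => //; exact/pseudo_unitary_unit/SU_pseudo_unitary.
Qed.

(** Having real entries means being fixed by conjugation, which commutes with products and
    inverses. *)
Lemma SO_ldiv p q : ldiv_closed (SO R p q).
Proof.
move=> g h [gG gR] [hG hR]; split; first exact: SU_ldiv.
have realE (x : C) : complex.Im x = 0 -> x^* = x 
    by case: x => a b /= ->; apply/eqP; rewrite eq_complex /= oppr0 !eqxx.
have realE' (x : C) : x^* = x -> complex.Im x = 0.
  case: x => a b /eqP; rewrite eq_complex /= eqxx -subr_eq0 -opprD oppr_eq0 -mulr2n.
  by rewrite mulrn_eq0 => /eqP.
have adjR (x : 'M[C]_(p + q)) : (forall i j, complex.Im (x i j) = 0) -> map_mx Num.conj x = x.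
  by move=> xR; apply/matrixP => i j; rewrite mxE realE.
move=> i j /=; apply: realE'.
have -> : ((invmx g *m h) i j)^* = (map_mx Num.conj (invmx g *m h)) i j by rewrite [RHS]mxE.
by rewrite map_mxM map_invmx !adjR.
Qed.

(** The translate g^-1 G0 of the component G0 is connected, lies in G and contains 1 = g^-1 g, so it
    is contained in G0. *)
Lemma connected_component_ldiv n (G : set 'M[C]_n) : (forall g, G g -> g \in unitmx) ->
  ldiv_closed G -> ldiv_closed (connected_component G 1%:M).
Proof.
move=> Gu Gdiv g h gG hG; have gG' := connected_component_sub gG.
have : connected_component G 1%:M h by [].
set G0 := connected_component G 1%:M in gG hG *.
suff : mulmx (invmx g) @` G0 `<=` G0 by move=> H hG0; apply: H; exists h.
apply: connected_component_max.
- by exists g => //; rewrite mulVmx // Gu.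
- by move=> _ [k kG <-]; apply: Gdiv => //; exact: connected_component_sub kG.
- apply: connected_continuous_connected; first exact: component_connected.
  exact/continuous_subspaceT/continuous_mulmx.
Qed.

Variable T : hermitian_type.
Local Notation G := (hermitian_group R T).
Local Notation H := (series_group R T).

Lemma series_group_SU : H `<=` SU R (ulsize T) (drsize T).
Proof. by case: T => [p q|m|m|p] g //= []. Qed.

Lemma hermitian_group_sub : G `<=` H.
Proof. by case: T => [p q|m|m|p] g //= /connected_component_sub[]. Qed.

Lemma hermitian_group_ldiv : ldiv_closed G.
Proof.
case: T => [p q|m|m|p].
- exact: SU_ldiv.
- exact: Sp_ldiv.
- exact: SOstar_ldiv.
- apply: connected_component_ldiv; last exact: SO_ldiv.
  by move=> g [/SU_pseudo_unitary/pseudo_unitary_unit].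
Qed.

Lemma series_group_ldiv : ldiv_closed H.
Proof.
case: T => [p q|m|m|p]; [exact: SU_ldiv|exact: Sp_ldiv|exact: SOstar_ldiv|].
exact: SU_ldiv.
Qed.

Lemma closed_series_group : closed H.
Proof.
case: T => [p q|m|m|p]; [exact: closed_SU| | |exact: closed_SU];
  by apply: closedI; [exact: closed_SU|exact: closed_trmx_form].
Qed.

Lemma closed_hermitian_group : closed G.
Proof.
case: T => [p q|m|m|p]; [exact: closed_SU| | |]; last first.
  exact/component_closed/closed_SO.
all: by apply: closedI; [exact: closed_SU|exact: closed_trmx_form].
Qed.

End ClassicalGroups.

(** * Volume growth and integrability of the weight *)

Section BorelMatrices.
Variables (R : realType) (n : nat).
Local Notation C := R[i].
Local Notation borel := (borel_mx R n).

Lemma borel_open (U : set borel) : open (U : set 'M[C]_n) -> measurable U.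
Proof. exact: sub_sigma_algebra. Qed.

Lemma borel_closed (U : set borel) : closed (U : set 'M[C]_n) -> measurable U.
Proof.
move=> Uc; rewrite -[U]setCK; apply: measurableC; apply: borel_open.
exact: (closed_openC (Uc : closed (U : set 'M[C]_n))).
Qed.

(** Continuity is required only at the points of D, so the preimage of an interval need not be open;
    on D it agrees with its interior. *)
Lemma borel_measurable_fun (D : set borel) (f : borel -> R) : measurable D ->
  (forall x : 'M[C]_n, D x -> continuous_at x (f : 'M[C]_n -> R)) -> measurable_fun D f.
Proof.
move=> mD fc; apply: (measurability _ (RGenOpens.measurableE R)).
move=> _ [_ [a [b ->] <-]].
rewrite (_ : D `&` _ = D `&` ((f : 'M[C]_n -> R) @^-1` `]a, b[%classic)°%classic).
  by apply: measurableI => //; apply: borel_open; exact: open_interior.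
apply/seteqP; split=> x [Dx fx]; split=> //; last exact: (interior_subset fx).
apply: (fc x Dx); exact: open_nbhs_nbhs (conj (interval_open _ _) fx).
Qed.

Lemma measurable_mulmx (k : 'M[C]_n) :
  measurable_fun [set: borel] (mulmx k : borel -> borel).
Proof.
apply: (@measurability _ _ borel borel setT _ [set U : set 'M[C]_n | open U]) => //.
move=> _ [U oU <-]; rewrite setTI; apply: borel_open.
by apply: open_comp => // x _; exact: continuous_mulmx.
Qed.

Lemma measurable_mulmx_image (k : 'M[C]_n) (A : set borel) : k \in unitmx ->
  measurable A -> measurable (mulmx k @` A : set borel).
Proof.
move=> ku mA; rewrite (_ : mulmx k @` A = mulmx (invmx k) @^-1` A).
  by rewrite -[X in measurable X]setTI; exact: measurable_mulmx.
apply/seteqP; split=> [_ [x Ax <-]|x /= Ax]; first by rewrite /= mulKmx.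
by exists (invmx k *m x) => //; rewrite mulKVmx.
Qed.

End BorelMatrices.

(** * Polynomial growth of the Haar measure *)

Section VolumeGrowth.
Variables (R : realType).
Local Notation C := R[i].

(** Bounding real and imaginary parts separately makes the box a cube in real coordinates, ready to
    be cut by a grid. *)
Definition mx_box m n (b : R) : set 'M[C]_(m, n) := [set M | forall i j,
  `|complex.Re (M i j)| <= b /\ `|complex.Im (M i j)| <= b].

Lemma closed_mx_box m n (b : R) : closed (@mx_box m n b).
Proof.
apply: compact_closed; last exact: compact_mx_box.
exact: (@norm_hausdorff C 'M[C]_(m, n)).
Qed.

Lemma norm_ReIm (x : C) : `|x| <= (`|complex.Re x| + `|complex.Im x|)%:C%C.
Proof.
rewrite normc_def lecR -[leRHS]ger0_norm ?addr_ge0 // -sqrtr_sqr ler_wsqrtr //.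
rewrite -(real_normK (num_real (complex.Re x))) -(real_normK (num_real (complex.Im x))).
by rewrite sqrrD lerD2r lerDl mulrn_wge0 // mulr_ge0.
Qed.

(** The shift by b makes the coordinates nonnegative, so that [truncn] is the index of a grid cell
    of side N^-1. *)
Lemma truncn_eq_close (x y b N : R) : 0 < N -> `|x| <= b -> `|y| <= b ->
  Num.truncn ((x + b) * N) = Num.truncn ((y + b) * N) -> `|x - y| <= N^-1.
Proof.
move=> N0; rewrite ler_norml => /andP[xb _]; rewrite ler_norml => /andP[yb _] eq_t.
have x0 : 0 <= (x + b) * N by rewrite mulr_ge0 ?(ltW N0) // -lerBlDr sub0r.
have y0 : 0 <= (y + b) * N by rewrite mulr_ge0 ?(ltW N0) // -lerBlDr sub0r.
have /andP[x1 x2] := truncn_itv x0; have /andP[y1 y2] := truncn_itv y0.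
rewrite -eq_t in y1 y2; move: x1 x2 y1 y2; set t := Num.truncn _ => x1 x2 y1 y2.
rewrite -[N^-1]mul1r ler_pdivlMr // -[X in _ * X](gtr0_norm N0) -normrM.
by rewrite ler_norml; rewrite -natr1 in x2 y2; lra.
Qed.

Section Haar.
Variables (p q : nat).
Local Notation n := (p + q)%N.
Local Notation borel := (borel_mx R n).
Variable G : set 'M[C]_n.
Hypotheses (G_pu : forall g, G g -> pseudo_unitary g) (G_closed : closed G)
  (G_ldiv : ldiv_closed G).
Variable mu : {measure set borel -> \bar R}.
Hypothesis G_haar : haar G mu.

Lemma haar_neq0 : exists g, G g.
Proof.
apply: contrapT => G0; case: G_haar => + _ _; rewrite (_ : G = set0) ?measure0 ?ltxx //.
by apply/seteqP; split=> // g Gg; apply: G0; exists g.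
Qed.

Lemma G_one : G 1%:M.
Proof.
have [g gG] := haar_neq0; rewrite -(mulVmx (pseudo_unitary_unit (G_pu gG))).
exact: G_ldiv.
Qed.

Lemma G_mul g h : G g -> G h -> G (g *m h).
Proof.
move=> gG hG; rewrite -[g]invmxK; apply: G_ldiv => //.
by rewrite -[invmx g]mulmx1; apply: G_ldiv => //; exact: G_one.
Qed.

(** As g^-1 = I g^*m I, the inverse is the adjoint up to signs; a bound on the entries of g is thus
    one on those of g^-1. *)
Lemma norm_invmx_entry g i j : G g -> `|invmx g i j| = `|g j i|.
Proof.
move=> /G_pu gU; rewrite pseudo_unitary_inv //.
have -> : `|g j i| = `|g^*m i j| by rewrite !mxE norm_conjC.
rewrite -[g^*m]submxK /sign_mx !mulmx_block !mul0mx !mulmx0 !addr0 !add0r.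
rewrite !mul1mx !mulNmx !mul1mx !mulmxN !mulmx1 opprK.
case: (split_ordP i) => i' ->; case: (split_ordP j) => j' ->.
- by rewrite !block_mxEul.
- by rewrite !block_mxEur mxE normrN.
- by rewrite !block_mxEdl mxE normrN.
- by rewrite !block_mxEdr.
Qed.

Local Notation unit_box := (G `&` mx_box 2 : set borel).

(** Write g^-1 h = 1 + g^-1 (h - g). The factors have entries at most 2 j and 2 / (c j), and each
    entry of the product has n terms, so it is at most 4 n / c <= 1. *)
Lemma close_quotient_box g h (j c : nat) : (0 < j)%N -> (4 * n <= c)%N -> (0 < c)%N ->
  G g -> G h -> mx_box j%:R g ->
  mx_box ((c * j)%:R^-1) (h - g) -> mx_box 2 (invmx g *m h).
Proof.
move=> j0 nc c0 gG hG gb hgb.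
have eqI : invmx g *m h = 1%:M + invmx g *m (h - g).
  have gu := pseudo_unitary_unit (G_pu gG).
  by rewrite mulmxBr mulVmx // [RHS]addrC subrK.
have e1 i k : `|(invmx g *m (h - g)) i k| <= 1.
  rewrite mxE (le_trans (ler_norm_sum _ _ _)) //.
  apply: (@le_trans _ _ (\sum_(l < n) (4 / c%:R : R)%:C%C)).
    apply: ler_sum => l _; rewrite normrM norm_invmx_entry //.
    have b1 : `|g l i| <= (2 * j%:R)%:C%C.
      apply: le_trans (norm_ReIm _) _; rewrite lecR mulr_natl mulr2n.
      by have [? ?] := gb l i; exact: lerD.
    have b2 : `|(h - g) l k| <= (2 * (c * j)%:R^-1)%:C%C.
      apply: le_trans (norm_ReIm _) _; rewrite lecR mulr_natl mulr2n.
      by have [? ?] := hgb l k; exact: lerD.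
    apply: le_trans (ler_pM _ _ b1 b2) _ => //.
    rewrite -rmorphM lecR natrM invfM.
    have jr : j%:R != 0 :> R by rewrite pnatr_eq0 -lt0n.
    have cr : c%:R != 0 :> R by rewrite pnatr_eq0 -lt0n.
    by rewrite le_eqVlt; apply/orP; left; apply/eqP; field; rewrite jr cr.
  rewrite sumr_const card_ord -rmorphMn [leRHS](_ : _ = (1 : R)%:C%C) // lecR.
  by rewrite -mulr_natr mulrAC ler_pdivrMr ?ltr0n // mul1r -natrM ler_nat.
have e2 i k : `|(invmx g *m h) i k| <= 2%:R.
  rewrite eqI mxE (le_trans (ler_normD _ _)) // -[leRHS]/(1 + 1)%:R natrD lerD // mxE.
  by case: eqP => _; rewrite ?normr1 ?normr0.
move=> i k; have := e2 i k; rewrite [leRHS](_ : _ = (2 : R)%:C%C) => [e|]; last by rewrite rmorph_nat.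
by split; rewrite -lecR; apply: le_trans e; [exact: normRe|exact: normIm].
Qed.

(** Choose a point of G in every nonempty cell of a grid on the 2 n^2 real coordinates; by
    [close_quotient_box] the part of G in the cell lies in the translate of [unit_box] by this
    point, of measure v. *)
Lemma volume_growth : exists2 M : R, 0 <= M & forall j : nat, (0 < j)%N ->
  (mu (G `&` mx_box j%:R) <= (M * (j%:R ^+ 2) ^+ (n * n * 2))%:E)%E.
Proof.
have Uc : compact unit_box.
  apply: (@subclosed_compact _ _ (mx_box 2)); last by move=> x [].
    by apply: closedI => //; exact: closed_mx_box.
  exact: compact_mx_box.
have [_ /(_ _ Uc (@subIsetl _ _ _)) Ufin mu_inv] := G_haar.
have mU : measurable unit_box.
  by apply: borel_closed; apply: closedI => //; exact: closed_mx_box.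
have [v v0 Uv] : exists2 v : R, 0 <= v & mu unit_box = v%:E.
  exists (fine (mu unit_box)); first by rewrite fine_ge0.
  by rewrite fineK // ge0_fin_numE.
(* Large enough for [close_quotient_box]; the successor keeps it positive even when n = 0. *)
pose c := (4 * n).+1.
exists (v * (2 * c).+1%:R ^+ (n * n * 2)) => [|j j0].
  by rewrite mulr_ge0 ?exprn_ge0.
(* Cells per real coordinate: an interval of length 2 j, cells of side 1 / (c j), and one more for
   the right endpoint. As j >= 1, this is at most (2 c + 1) j^2. *)
pose N := (2 * c * j ^ 2).+1.
have cj0 : (0 : R) < (c * j)%:R by rewrite ltr0n muln_gt0 /=.
pose coord (g : 'M[C]_n) (t : 'I_n * 'I_n * bool) : R :=
  if t.2 then complex.Re (g t.1.1 t.1.2) else complex.Im (g t.1.1 t.1.2).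
pose cell (g : 'M[C]_n) : {ffun 'I_n * 'I_n * bool -> 'I_N} :=
  [ffun t => inord (Num.truncn ((coord g t + j%:R) * (c * j)%:R))].
have coord_le g t : mx_box j%:R g -> `|coord g t| <= j%:R.
  by move=> gb; rewrite /coord; case: ifP => _; have [] := gb t.1.1 t.1.2.
(* An empty cell receives the identity, so [pt s] always lies in G. *)
pose pt s := xget 1%:M [set g | (G `&` mx_box j%:R) g /\ cell g = s].
have ptG s : G (pt s).
  by rewrite /pt; case: xgetP => [_ _ [[]]|_] //; exact: G_one.
have pt_cell g : (G `&` mx_box j%:R) g -> (mulmx (pt (cell g)) @` unit_box) g.
  move=> [gG gb]; rewrite /pt; case: xgetP => [h _ [[hG hb] eq_cell]|/(_ g)]; last by case.
  exists (invmx h *m g); last by rewrite mulKVmx //; exact/pseudo_unitary_unit/G_pu.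
  split; first exact: G_ldiv.
  apply: (@close_quotient_box _ _ j c) => // i k.
  have close t : `|coord g t - coord h t| <= (c * j)%:R^-1.
    apply: (truncn_eq_close cj0 (coord_le _ _ gb) (coord_le _ _ hb)).
    have lt_t g' : mx_box j%:R g' ->
        (Num.truncn ((coord g' t + j%:R) * (c * j)%:R) < N)%N.
      move=> gb'; have := coord_le _ t gb'; rewrite ler_norml => /andP[l1 l2].
      have [t0 tN] : 0 <= (coord g' t + j%:R) * (c * j)%:R /\
          (coord g' t + j%:R) * (c * j)%:R <= (2 * c * j ^ 2)%:R :> R.
        split; first by rewrite mulr_ge0 // -lerBlDr sub0r.
        rewrite (_ : (2 * c * j ^ 2)%N = (2 * j * (c * j))%N); last by rewrite mulnACA -mulnA.
        by rewrite [leRHS]natrM ler_pM2r // mul2n -addnn natrD lerD2r.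
      rewrite ltnS -(ler_nat R); apply: le_trans tN.
      by have /andP[] := truncn_itv t0.
    have /ffunP/(_ t) := eq_cell; rewrite !ffunE => /(congr1 val).
    by rewrite /= !inordK ?lt_t.
  by rewrite !mxE ReB ImB; split; [exact: (close (i, k, true))|exact: (close (i, k, false))].
(* The cells are numbered by naturals, to apply subadditivity to a sequence of sets. *)
pose B k := mulmx (pt (nth (cell 1%:M) (enum {ffun 'I_n * 'I_n * bool -> 'I_N}) k)) @` unit_box.
have mB k : measurable (B k : set borel).
  by apply: measurable_mulmx_image => //; exact/pseudo_unitary_unit/G_pu.
have := @content_subadditive _ _ _ mu (G `&` mx_box j%:R) B
  #|{ffun 'I_n * 'I_n * bool -> 'I_N}|.
move=> /(_ (fun k _ => mB k)) H; apply: le_trans (H _ _) _.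
- by apply: borel_closed; apply: closedI => //; exact: closed_mx_box.
- move=> g gGb; rewrite -bigcup_mkord; exists (index (cell g) (enum {ffun 'I_n * 'I_n * bool -> 'I_N})).
    by rewrite /= cardE index_mem mem_enum.
  by rewrite /B nth_index ?mem_enum //; exact: pt_cell.
have muB k : mu (B k) = v%:E by rewrite /B mu_inv // -Uv.
apply: (@le_trans _ _ (\sum_(k < #|{ffun 'I_n * 'I_n * bool -> 'I_N}|) v%:E)%E).
  by apply: lee_sum => k _; rewrite le_eqVlt; apply/orP; left; apply/eqP; exact: muB.
rewrite sumEFin lee_fin sumr_const card_ffun !card_prod card_bool !card_ord.
rewrite -mulrA -[leLHS]mulr_natr ler_wpM2l // natrX -exprMn lerXn2r ?nnegrE //.
rewrite -natrX -natrM ler_nat /N.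
by rewrite mulSn -add1n leq_add2r expn_gt0 j0.
Qed.

End Haar.
End VolumeGrowth.

(** * Integrability of negative powers of the determinant *)

Section DeterminantWeight.
Variables (R : realType).
Local Notation C := R[i].
Local Notation normc := (@Normc.normc R).

Lemma normcE (x : C) : `|x| = (normc x)%:C%C.
Proof. by rewrite normc_def; case: x. Qed.

Lemma normc_ge0 (x : C) : 0 <= normc x.
Proof. by case: x => a b; exact: sqrtr_ge0. Qed.

Lemma normc_gt0 (x : C) : (0 < normc x) = (x != 0).
Proof.
rewrite lt0r normc_ge0 andbT; congr (~~ _); apply/eqP/eqP => [|->].
  exact: Normc.eq0_normc.
exact: Normc.normc0.
Qed.

Lemma normc_continuous : continuous normc.
Proof.
move=> x; apply/(@cvgrPdist_lt _ R^o C (nbhs x) (nbhs_filter x)) => e e0.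
apply: nbhs_complexP; exists e => // y xy; rewrite -ltcR; apply: le_lt_trans xy.
have -> : (`|normc x - normc y|)%:C%C = `|(normc x - normc y)%:C%C|.
  by rewrite normc_def /= expr0n addr0 sqrtr_sqr.
have -> : (normc x - normc y)%:C%C = `|x| - `|y|.
  by rewrite !normcE; exact: (rmorphB (real_complex R)).
exact: ler_dist_dist.
Qed.

Lemma continuous_at_drsubmx p q (g : 'M[C]_(p + q)) :
  mx_continuous_at g (fun x : 'M[C]_(p + q) => drsubmx x).
Proof. by move=> i j; under eq_fun do rewrite !mxE; exact: continuous_at_coord. Qed.

(** On the group this is the modulus of psi_l ([normc_psi]), and with exponent 2 l the Bergman
    weight along the orbit of 0 ([weight_mobius0]). *)
Definition det_weight p q l (g : 'M[C]_(p + q)) : R := normc (\det (drsubmx g)) ^- l.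

Lemma continuous_at_det_weight p q l (g : 'M[C]_(p + q)) :
  drsubmx g \in unitmx -> continuous_at g (@det_weight p q l).
Proof.
move=> gu; have d0 : normc (\det (drsubmx g)) ^+ l != 0.
  by rewrite expf_neq0 // gt_eqF // normc_gt0 -unitfE -unitmxE.
have dc : continuous_at g (fun x => normc (\det (drsubmx x)) ^+ l).
  apply: (@continuous_at_exp R _ g (fun x => normc (\det (drsubmx x)))).
  have dc' := continuous_at_det (@continuous_at_drsubmx p q g).
  exact: (cvg_comp _ _ dc' (@normc_continuous _)).
exact: (@cvgV R _ (nbhs g) _ _ _ d0 dc).
Qed.

Section Integral.
Variables (p q : nat).
Local Notation n := (p + q)%N.
Local Notation borel := (borel_mx R n).
Variable G : set 'M[C]_n.
Hypotheses (G_pu : forall g, G g -> pseudo_unitary g) (G_closed : closed G)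
  (G_ldiv : ldiv_closed G).

Lemma measurable_det_weight l : measurable_fun (G : set borel) (@det_weight p q l).
Proof.
apply: borel_measurable_fun; first exact: borel_closed.
by move=> x /G_pu/drsubmx_unit; exact: continuous_at_det_weight.
Qed.

Lemma det_weight_ge0 l g : 0 <= @det_weight p q l g.
Proof. by rewrite invr_ge0 exprn_ge0 // normc_ge0. Qed.

(** One more than the exponent e = 2 n^2 of [volume_growth]: a box of size x has measure of order at
    most x^(2 e), and the weight on its shell decays like x^(-2 l), so l > e makes the dyadic sum
    converge. *)
Definition min_weight := (n * n * 2).+1.

Variable mu : {measure set borel -> \bar R}.
Hypothesis G_haar : haar G mu.

Lemma integral_det_weight l : (min_weight <= l)%N ->
  (\int[mu]_(g in G) (det_weight (2 * l) g)%:E < +oo)%E.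
Proof.
move=> ll; have [M M0 muM] := volume_growth G_pu G_closed G_ldiv G_haar.
have mG : measurable (G : set borel) by exact: borel_closed.
pose B (i : nat) : set borel := G `&` mx_box (2 ^ i.+1)%:R.
have mB i : measurable (B i) by apply: borel_closed; apply: closedI => //; exact: closed_mx_box.
pose k : R := (entry_cst q)%:R.
pose a (i : nat) : R := k ^+ (2 * l) * (2 ^ i)%:R ^- (2 * l).
have a0 i : 0 <= a i by rewrite mulr_ge0 ?exprn_ge0 ?invr_ge0 ?exprn_ge0 ?ler0n.
(* [S] collects the constants in the bound for a_i mu(B_i); the factors 4^e and 2 come from the box
   size 2^(i + 1). *)
pose S : R := 2 * k ^+ (2 * l) * M * 4 ^+ (n * n * 2).
have S0 : 0 <= S by rewrite !mulr_ge0 ?exprn_ge0 ?ler0n.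
(* Take i the dyadic logarithm of k |\det D|: the upper bound 2^(i + 1) puts g in the box by
   [pseudo_unitary_entry_le], the lower bound 2^i controls the weight. *)
have shell g : G g -> exists i, B i g /\ det_weight (2 * l) g <= a i.
  move=> gG; have gU := G_pu gG; set d := normc (\det (drsubmx g)).
  have kd i j : `|g i j| <= (k * d)%:C%C.
    have := pseudo_unitary_entry_le i j gU.
    by rewrite [X in _ * X]normcE rmorphM /= (rmorph_nat (real_complex R)).
  have kd1 : 1 <= k * d.
    have := det_drsubmx_ge gU; rewrite normcE -(rmorph_nat (real_complex R)) -rmorphM.
    rewrite -[X in X <= _](rmorph1 (real_complex R)) lecR => /le_trans; apply.
    rewrite ler_wpM2r ?normc_ge0 // ler_nat /entry_cst.
    by rewrite leq_pmull // expn_gt0.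
  pose t := Num.truncn (k * d).
  have /andP[t1 t2] := truncn_itv (le_trans ler01 kd1).
  have t0 : (0 < t)%N by rewrite truncn_gt0.
  have /= /andP[i1 i2] := trunc_log_bounds (isT : 1 < 2)%N t0.
  exists (trunc_log 2 t); set i := trunc_log 2 t in i1 i2 *.
  have le1 : (2 ^ i)%:R <= k * d by apply: le_trans t1; rewrite ler_nat.
  have le2 : k * d <= (2 ^ i.+1)%:R.
    by apply: le_trans (ltW t2) _; rewrite ler_nat.
  split.
    split=> // r c; have le_rc : `|g r c| <= ((2 ^ i.+1)%:R : R)%:C%C.
      by apply: le_trans (kd r c) _; rewrite lecR.
    by split; rewrite -lecR; apply: le_trans le_rc; [exact: normRe|exact: normIm].
  have d0 : 0 < d by rewrite normc_gt0 -unitfE -unitmxE drsubmx_unit.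
  have k0 : 0 < k by rewrite -(pmulr_lgt0 _ d0) (lt_le_trans ltr01).
  have p0 : 0 < (2 ^ i)%:R :> R by rewrite ltr0n expn_gt0.
  rewrite /det_weight -/d /a -!exprVn -exprMn.
  rewrite lerXn2r ?nnegrE ?invr_ge0 ?(ltW d0) ?mulr_ge0 ?(ltW k0) ?invr_ge0 ?(ltW p0) //.
  by rewrite ler_pdivlMr // mulrC ler_pdivrMr.
(* The boxes overlap, but the sum of the [F i] serves only as an upper bound. *)
pose F (i : nat) (g : borel) : \bar R := (a i * \1_(B i) g)%:E.
have F0 i g : (0 <= F i g)%E by rewrite lee_fin mulr_ge0 // indicE ler0n.
have mF i : measurable_fun (G : set borel) (F i).
  apply/measurable_EFinP; apply: measurable_funM; first exact: measurable_cst.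
  exact: measurable_indic.
apply: (@le_lt_trans _ _ (\int[mu]_(g in G) \sum_(0 <= i <oo) F i g)%E).
  apply: ge0_le_integral => //.
  - by move=> g _; rewrite lee_fin det_weight_ge0.
  - by apply/measurable_EFinP; exact: measurable_det_weight.
  - by apply: ge0_emeasurable_sum => // i g _ _; exact: F0.
  move=> g /shell[i [Big le_i]].
  apply: (@le_trans _ _ (F i g)).
    by rewrite lee_fin /F indicE mem_set // mulr1.
  apply: le_trans (nneseries_lim_ge i.+1 _) => //.
  rewrite big_nat_recr //= leeDr // sume_ge0 //.
rewrite integral_nneseries //.
have muB i : (\int[mu]_(g in G) F i g = (a i)%:E * mu (B i))%E.
  rewrite /F (@integralZl_indic _ _ _ _ _ _ (fun=> B i)) //; last first.
    by move=> ai; have := a0 i; rewrite leNgt ai.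
  by rewrite integral_indic // setIC setIA setIid.
apply: (@le_lt_trans _ _ (\sum_(0 <= i <oo) (S / (2 ^ i.+1)%:R)%:E)%E); last first.
  by apply: le_lt_trans (epsilon_trick0 _ S0) _; rewrite ltry.
apply: lee_nneseries => [i _ _|i _].
  by rewrite muB mule_ge0 // lee_fin.
rewrite muB; apply: le_trans (lee_wpmul2l _ (muM (2 ^ i.+1)%N _)) _.
- by rewrite lee_fin.
- by rewrite expn_gt0.
rewrite -EFinM lee_fin /a /S expnS natrM; set x : R := (2 ^ i)%:R; set e := (n * n * 2)%N.
have x1 : 1 <= x by rewrite ler1n expn_gt0.
have x0 : 0 < x := lt_le_trans ltr01 x1.
(* The choice of [min_weight] gives 2 e < 2 l, leaving at least one factor x^-1. *)
have le_x : x ^+ (2 * e) * x ^- (2 * l) <= x^-1.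
  rewrite ler_pdivrMr ?exprn_gt0 // (_ : 2 * l = (2 * l).-1.+1)%N; last first.
    by rewrite prednK // muln_gt0 /= (leq_trans _ ll).
  rewrite exprS mulKf ?gt_eqF // ler_weXn2l //.
  rewrite -ltnS prednK ?muln_gt0 /= ?(leq_trans _ ll) //.
  by rewrite ltn_pmul2l.
have -> : k ^+ (2 * l) * x ^- (2 * l) * (M * (2%:R * x) ^+ 2 ^+ e) =
    k ^+ (2 * l) * M * 4 ^+ e * (x ^+ (2 * e) * x ^- (2 * l)).
  have -> : (2%:R * x) ^+ 2 ^+ e = 4 ^+ e * x ^+ (2 * e).
    by rewrite exprM -exprMn; congr (_ ^+ _); ring.
  move: (k ^+ (2 * l)) (x ^- (2 * l)) (4 ^+ e) (x ^+ (2 * e)) => A1 A2 A3 A4; ring.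
have -> : 2 * k ^+ (2 * l) * M * 4 ^+ e / (2%:R * x) = k ^+ (2 * l) * M * 4 ^+ e * x^-1.
  by field; rewrite gt_eqF.
by rewrite ler_wpM2l // !mulr_ge0 ?exprn_ge0 ?ler0n.
Qed.

End Integral.
End DeterminantWeight.

(** * The mean value property *)

Section DifferentiablePolynomials.
Variables (K : numFieldType) (V : normedModType K) (x : V).

Lemma differentiable_big_sum I (s : seq I) (F : I -> V -> K) :
  (forall i, differentiable (F i) x) -> differentiable (fun y => \sum_(i <- s) F i y) x.
Proof.
move=> Fd; elim: s => [|i s ihs].
  by under eq_fun do rewrite big_nil; exact: differentiable_cst.
by under eq_fun do rewrite big_cons; exact: (differentiableD (Fd i)).
Qed.

Lemma differentiable_big_prod I (s : seq I) (F : I -> V -> K) :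
  (forall i, differentiable (F i) x) -> differentiable (fun y => \prod_(i <- s) F i y) x.
Proof.
move=> Fd; elim: s => [|i s ihs].
  by under eq_fun do rewrite big_nil; exact: differentiable_cst.
by under eq_fun do rewrite big_cons; exact: (differentiableM (Fd i)).
Qed.

Lemma differentiable_det n (M : V -> 'M[K]_n) :
  (forall i j, differentiable (fun y => M y i j) x) -> differentiable (fun y => \det (M y)) x.
Proof.
move=> Md; apply: differentiable_big_sum => s.
apply: (@differentiableM _ _ (fun=> (-1) ^+ s)); first exact: differentiable_cst.
by apply: differentiable_big_prod => i; exact: Md.
Qed.

Lemma differentiable_adj n (M : V -> 'M[K]_n) i j :
  (forall i j, differentiable (fun y => M y i j) x) -> differentiable (fun y => \adj (M y) i j) x.
Proof.
move=> Md; under eq_fun do rewrite mxE.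
apply: (@differentiableM _ _ (fun=> (-1) ^+ (j + i))); first exact: differentiable_cst.
by apply: differentiable_det => k l; under eq_fun do rewrite !mxE; exact: Md.
Qed.

Lemma differentiable_exprV (f : V -> K) k :
  differentiable f x -> f x != 0 -> differentiable (fun y => f y ^- k) x.
Proof.
move=> fd fx; under eq_fun do rewrite -exprVn.
elim: k => [|k ihk]; first by under eq_fun do rewrite expr0; exact: differentiable_cst.
under eq_fun do rewrite exprS.
exact: (differentiableM (differentiableV fd fx) ihk).
Qed.

End DifferentiablePolynomials.

(** In characteristic 0 the polynomial X^N - 1 is separable, so there are N distinct N-th roots of
    unity, which forces a primitive one. *)
Lemma has_primitive_root (F : numClosedFieldType) N : (0 < N)%N ->
  exists w : F, N.-primitive_root w.
Proof.
move=> N0; have [s sE] := closed_field_poly_normal ('X^N - 1 : {poly F}).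
rewrite (monicP (monicXnsubC _ N0)) scale1r in sE.
have unity_s : all N.-unity_root s.
  by apply/allP => z; rewrite -root_prod_XsubC -sE.
have uniq_s : uniq s.
  by rewrite -separable_prod_XsubC -sE separable_Xn_sub_1 // pnatr_eq0 -lt0n.
have size_s : (N < (size s).+1)%N by rewrite -(size_prod_XsubC s id) -sE size_XnsubC.
by have /hasP[w _ wN] := has_prim_root N0 unity_s uniq_s size_s; exists w.
Qed.

Lemma norm_prim_root (F : numClosedFieldType) N (w : F) : (0 < N)%N ->
  N.-primitive_root w -> `|w| = 1.
Proof.
move=> N0 /prim_expr_order wN; apply/eqP.
by rewrite -(pexpr_eq1 N0) // -normrX wN normr1.
Qed.

(** * Limits of determinants of Neumann sums *)

Section NeumannLimit.
Variable R : realType.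
Local Notation C := R[i].
Local Notation normc := (@Normc.normc R).

Lemma cvg_mx_entry T (F : set_system T) {FF : Filter F} m n
    (M : T -> 'M[C]_(m, n)) (L : 'M[C]_(m, n)) :
  (forall i j, M y i j @[y --> F] --> L i j) -> M @ F --> L.
Proof.
move=> Mc A [P MP PA].
have PM i j : \forall y \near F, P i j (M y i j) by exact: (Mc i j _ (MP i j)).
have : \forall y \near F, forall ij : 'I_m * 'I_n, P ij.1 ij.2 (M y ij.1 ij.2).
  by apply: filter_forall => -[i j]; exact: PM.
by apply: filterS => y Py; apply: PA => i j; exact: (Py (i, j)).
Qed.

(** By [det_neumann] the product of the two determinants is \det (1 - (- M)^k), which tends to 1
    because the powers of M tend to 0. *)
Lemma det_neumann_cvg n (M : 'M[C]_n) (r b : R) : 0 <= r < 1 ->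
  (forall k i j, `|(M ^+ k) i j| <= (r ^+ k)%:C%C) ->
  (forall k, normc (\det (neumann k M)) <= b) ->
  \det (1%:M + M) != 0 /\ \det (neumann k M) @[k --> \oo] --> (\det (1%:M + M))^-1.
Proof.
move=> /andP[r0 r1] Mr nb.
have lim1 : \det (1%:M - (- M) ^+ k) @[k --> \oo] --> (1 : C).
  have detc : continuous (fun A : 'M[C]_n => \det A).
    by move=> A; apply: continuous_at_det => i j; exact: continuous_at_coord.
  suff lim : (1%:M - (- M) ^+ k) @[k --> \oo] --> (1%:M : 'M[C]_n).
    by have := cvg_comp _ _ lim (detc 1%:M); rewrite det1.
  apply: cvg_mx_entry => i j.
  apply: (iffRL (@cvgrPdist_lt _ C^o nat \oo%classic eventually_filter _ _)) => e e0.
  have [d eqe] : exists d : R, e = d%:C%C by exists (complex.Re e); rewrite RRe_real // gtr0_real.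
  have d0 : 0 < d by rewrite -ltcR -eqe.
  have rk : (r ^+ k) @[k --> \oo] --> (0 : R).
    by apply: cvg_expr; rewrite ger0_norm.
  have := iffLR (@cvgrPdist_lt _ R^o nat \oo%classic eventually_filter _ _) rk d d0.
  apply: filterS => k /=; rewrite sub0r normrN ger0_norm ?exprn_ge0 // => rd.
  rewrite !mxE opprD addNKr opprK -scaleN1r expmxZ mxE normrM normrX normrN1 expr1n mul1r.
  by rewrite eqe (le_lt_trans (Mr k i j)) // ltcR.
(* Were this determinant 0, the sequence tending to 1 would be constantly 0. *)
have P0 : \det (1%:M + M) != 0.
  apply/negP => /eqP P0; move: lim1.
  under eq_fun do rewrite -det_neumann P0 mulr0.
  move=> lim1; have e10 : (1 : C) = 0.
    by apply: (cvg_unique (@norm_hausdorff C C^o) lim1); exact: cvg_cst.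
  by move: (oner_neq0 C); rewrite e10 eqxx.
split; first exact: P0.
have eqk k : \det (1%:M - (- M) ^+ k) * (\det (1%:M + M))^-1 = \det (neumann k M).
  by rewrite -det_neumann mulfK.
have lim := @cvgM C _ \oo%classic _ _ _ _ _ lim1 (cvg_cst (\det (1%:M + M))^-1).
rewrite mul1r in lim.
exact: (eq_ind _ (fun f : nat -> C => f @ \oo --> (\det (1%:M + M))^-1)
  (lim eventually_filter eventually_filter) _ (funext eqk)).
Qed.

(** The constants depend on g alone: right multiplication by [mobius0 h] does not increase norms, so
    the rate of [ratio_contract] holds for all h at once. *)
Lemma ratio_neumann p q (g : 'M[C]_(p + q)) : pseudo_unitary g ->
  exists r b : R, 0 <= r < 1 /\ forall h, pseudo_unitary h ->
  let M := invmx (drsubmx g) *m dlsubmx g *m mobius0 h in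
  (forall k i j, `|(M ^+ k) i j| <= (r ^+ k)%:C%C) /\
  (forall k, normc (\det (neumann k M)) <= b).
Proof.
move=> gU; have [rho /andP[rho0 rho1] rhoP] := ratio_contract gU.
have [r er] : exists r : R, sqrtC rho = r%:C%C.
  by exists (complex.Re (sqrtC rho)); rewrite RRe_real // ger0_real // sqrtC_ge0.
have r0 : 0 <= r by rewrite -lecR -er sqrtC_ge0.
have r1 : r < 1.
  by rewrite -ltcR -er [ltRHS](_ : _ = sqrtC 1) ?ltr_sqrtC ?nnegrE // sqrtC1.
exists r, (q`!%:R * (1 - r)^-1 ^+ q); rewrite r0 r1; split=> // h hU M.
have Mrho (w : 'rV[C]_q) : \sum_j `|(w *m M) 0 j| ^+ 2 <= rho * \sum_j `|w 0 j| ^+ 2.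
  by rewrite mulmxA (le_trans (mobius0_contract _ hU)).
split=> [k i j|k].
  by rewrite rmorphXn /= -er contractX_entry.
rewrite -lecR -normcE; apply: le_trans (norm_det_le (fun i j => neumann_entry rho0 Mrho k i j rho1)) _.
by rewrite er rmorphM /= rmorph_nat rmorphXn /= fmorphV /= rmorphB /= rmorph1.
Qed.
End NeumannLimit.

(** * Left translation and integrals over the group *)

Section HaarTranslation.
Variables (R : realType) (p q : nat).
Local Notation C := R[i].
Local Notation n := (p + q)%N.
Local Notation borel := (borel_mx R n).
Local Notation normc := (@Normc.normc R).
Variable H : set 'M[C]_n.
Hypotheses (H_pu : forall g, H g -> pseudo_unitary g) (H_closed : closed H)
  (H_ldiv : ldiv_closed H).
Variable nu : {measure set borel -> \bar R}.
Hypothesis H_haar : haar H nu.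

Lemma measurable_group : measurable (H : set borel).
Proof. exact: borel_closed. Qed.
Let mH := measurable_group.

(** Extend f by 0 off H and push nu forward along multiplication by k: H is its own preimage, and on
    subsets of H the image measure is nu, by invariance under k^-1. *)
Lemma integral_translate (k : 'M[C]_n) (f : borel -> R) : H k ->
  measurable_fun (H : set borel) f ->
  nu.-integrable (H : set borel) (fun h => (f (k *m h))%:E) ->
  (\int[nu]_(h in (H : set borel)) (f (k *m h))%:E = \int[nu]_(h in (H : set borel)) (f h)%:E)%E.
Proof.
move=> kH mf kf.
have ku : k \in unitmx by exact/pseudo_unitary_unit/H_pu.
pose F : borel -> \bar R := (EFin \o f) \_ (H : set borel).
have mF : measurable_fun [set: borel] F.
  by apply/(measurable_restrictT _ mH); exact/measurable_EFinP.
have preH : (mulmx k : borel -> borel) @^-1` H = H.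
  apply/seteqP; split=> h /= hH; last exact: (G_mul H_pu H_ldiv H_haar).
  by rewrite -(mulKmx ku h); exact: H_ldiv.
have FH h : H h -> F h = (f h)%:E by move=> hH; rewrite /F patchE mem_set.
have FkH h : H h -> F (k *m h) = (f (k *m h))%:E.
  by move=> hH; apply: FH; exact: (G_mul H_pu H_ldiv H_haar).
have iF : nu.-integrable ((mulmx k : borel -> borel) @^-1` H) (F \o mulmx k).
  rewrite preH; apply: eq_integrable kf => //.
  by move=> h; rewrite inE => hH /=; rewrite FkH.
have := @integral_pushforward _ _ _ _ R _ (measurable_mulmx k) nu _ F mF iF mH.
rewrite preH (eq_measure_integral nu) => [|//|mk A mA AH].
- move=> eqF; rewrite [RHS](eq_integral F) => [|h]; last by rewrite inE => /FH.
  by rewrite eqF; apply: eq_integral => h; rewrite inE => /FkH.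
- exact: measurable_mulmx.
- have eqA : (mulmx k : borel -> borel) @^-1` A = [set invmx k *m x | x in A].
    apply/seteqP; split=> [h /= Ah|_ [h Ah <-]]; last by rewrite /= mulKVmx.
    by exists (k *m h) => //; rewrite mulKmx.
  suff : nu ((mulmx k : borel -> borel) @^-1` A) = nu A by [].
  rewrite eqA; case: H_haar => _ _ -> //.
  by rewrite -[invmx k]mulmx1; apply: H_ldiv => //; exact: (G_one H_pu H_ldiv H_haar).
Qed.

Variable l : nat.
Hypothesis l_large : (min_weight p q <= l)%N.
Local Notation w := (@det_weight R p q (2 * l)).

Lemma integrable_weight : nu.-integrable (H : set borel) (fun h => (w h)%:E).
Proof.
apply/integrableP; split.
  by apply/measurable_EFinP; exact: (measurable_det_weight H_pu H_closed).
apply: le_lt_trans (integral_det_weight H_pu H_closed H_ldiv H_haar l_large).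
rewrite le_eqVlt; apply/orP; left; apply/eqP; apply: eq_integral => h _.
by rewrite gee0_abs // lee_fin det_weight_ge0.
Qed.

Lemma integrable_le_weight (f : borel -> R) (c : R) : measurable_fun (H : set borel) f ->
  (forall h, H h -> `|f h| <= c * w h) -> nu.-integrable (H : set borel) (EFin \o f).
Proof.
move=> mf fw; apply: (le_integrable mH _ _ (integrableZl mH c integrable_weight)).
  exact/measurable_EFinP.
by move=> h /fw; rewrite /= lee_fin => /le_trans; apply; exact: ler_norm.
Qed.

(** The weight is positive on H; if its integral vanished, H would be a null set, against [haar].
    This allows dividing by the inner product of 1 with itself. *)
Lemma integral_weight_gt0 : (0 < \int[nu]_(h in (H : set borel)) (w h)%:E)%E.
Proof.
rewrite lt0e; apply/andP; split; last first.
  by apply: integral_ge0 => h _; rewrite lee_fin det_weight_ge0.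
apply/eqP => w0.
have mw : measurable_fun (H : set borel) (EFin \o w).
  apply/measurable_EFinP; exact: (measurable_det_weight H_pu H_closed).
have : (\int[nu]_(h in (H : set borel)) `|(EFin \o w) h| = 0)%E.
  rewrite -w0; apply: eq_integral => h _.
  by rewrite gee0_abs // lee_fin det_weight_ge0.
move=> /(ae_eq_integral_abs nu mH mw)[N [mN N0 HN]].
have HsubN : H `<=` N.
  move=> h hH; apply: HN => /= /(_ hH) /eqP; rewrite eqe => /eqP wh0.
  have : 0 < w h.
    by rewrite invr_gt0 exprn_gt0 // normc_gt0 -unitfE -unitmxE; exact/drsubmx_unit/H_pu.
  by rewrite wh0 ltxx.
have : (nu H <= nu N)%E by apply: le_measure; rewrite ?inE.
by case: H_haar => H0 _ _; rewrite N0 leNgt H0.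
Qed.

Lemma mx_continuous_at_exp m (T : topologicalType) (x : T) (M : T -> 'M[C]_m) k :
  mx_continuous_at x M -> mx_continuous_at x (fun y => M y ^+ k).
Proof.
move=> Mc; elim: k => [|k ihk]; first exact: mx_continuous_at_cst.
under eq_fun do rewrite exprS; exact: (mx_continuous_atM Mc ihk).
Qed.

(** [invmx] is defined by cases; it agrees with the adjugate formula, which is continuous, where the
    determinant is nonzero, an open condition. *)
Lemma mx_continuous_at_mobius0 (h : 'M[C]_n) : drsubmx h \in unitmx ->
  mx_continuous_at h (@mobius0 C p q).
Proof.
move=> hu.
pose z (x : 'M[C]_n) := ursubmx x *m ((\det (drsubmx x))^-1 *: \adj (drsubmx x)).
have detc : continuous_at h (fun x : 'M[C]_n => \det (drsubmx x)).
  exact/continuous_at_det/continuous_at_drsubmx.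
have det0 : \det (drsubmx h) != 0 by rewrite -unitfE -unitmxE.
have zc : mx_continuous_at h z.
  apply: mx_continuous_atM.
    by move=> i j; under eq_fun do rewrite !mxE; exact: continuous_at_coord.
  apply: mx_continuous_atZ; first exact: (@cvgV C _ (nbhs h) _ _ _ det0 detc).
  exact/mx_continuous_at_adj/continuous_at_drsubmx.
have nz : \forall x \near nbhs h, mobius0 x = z x.
  have : \forall x \near nbhs h, \det (drsubmx x) != 0.
    apply: (detc [set y | y != 0]); apply: open_nbhs_nbhs; split => //.
    rewrite (_ : mkset _ = ~` [set 0]); last by apply/seteqP; split=> y /eqP.
    apply: closed_openC; apply: accessible_closed_set1; apply: hausdorff_accessible.
    exact: (@norm_hausdorff C C^o).
  by apply: filterS => x x0; rewrite /mobius0 /invmx unitmxE unitfE x0.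
move=> i j; rewrite /continuous_at.
rewrite (nbhs_singleton nz) => A /(zc i j) Az.
have {}Az : \forall x \near nbhs h, A (z x i j) := Az.
suff : \forall x \near nbhs h, A (mobius0 x i j) by [].
have := @filterI _ (nbhs h) (nbhs_filter h) _ _ Az nz.
by apply: filterS => x [Ax eqx]; rewrite eqx.
Qed.
End HaarTranslation.

(** * Averaging over rotations and passage to the limit *)

Section MeanValue.
Variables (R : realType) (p q : nat).
Local Notation C := R[i].
Local Notation n := (p + q)%N.
Local Notation borel := (borel_mx R n).
Local Notation normc := (@Normc.normc R).

Lemma normcX (x : C) k : normc (x ^+ k) = normc x ^+ k.
Proof.
elim: k => [|k ihk]; first exact: Normc.normc1.
by rewrite !exprS Normc.normcM ihk.
Qed.

(* The exponents are those that make the determinant 1. *)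
Definition rotation (zeta : C) : 'M[C]_n :=
  block_mx (zeta ^+ q)%:M 0 0 (zeta^-1 ^+ p)%:M.

Lemma mul_rotation zeta (h : 'M[C]_n) : rotation zeta *m h =
  block_mx (zeta ^+ q *: ulsubmx h) (zeta ^+ q *: ursubmx h)
           (zeta^-1 ^+ p *: dlsubmx h) (zeta^-1 ^+ p *: drsubmx h).
Proof.
by rewrite -{1}[h]submxK mulmx_block !mul_scalar_mx !mul0mx !addr0 !add0r.
Qed.

Lemma rotation_pseudo_unitary zeta : `|zeta| = 1 -> pseudo_unitary (rotation zeta).
Proof.
move=> z1; have sc (m k : nat) (x : C) : `|x| = 1 -> ((x ^+ k)%:M : 'M[C]_m)^*m *m (x ^+ k)%:M = 1%:M.
  move=> x1; rewrite tr_scalar_mx map_scalar_mx -scalar_mxM; congr (_%:M).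
  by rewrite mulrC -normCK normrX x1 !expr1n.
rewrite /pseudo_unitary /rotation adjmx_block /sign_mx !mulmx_block.
rewrite !trmx0 !map_mx0 !mul0mx !mulmx0 !addr0 !add0r !mulmx1 !mul0mx mulmxN mulmx1 mulNmx.
by rewrite !sc ?normfV ?z1 ?invr1 // !mul0mx ?oppr0.
Qed.

Lemma det_rotation zeta : zeta != 0 -> \det (rotation zeta) = 1.
Proof.
by move=> z0; rewrite det_ublock !det_scalar -!exprM mulnC -exprMn divff // expr1n.
Qed.

(** The exponents q and p add up to n, so rotations scale the orbit of 0 by zeta^n; this scalar is
    the variable t of the polynomial mean. *)
Lemma mobius0_rotation zeta (h : 'M[C]_n) : zeta != 0 -> drsubmx h \in unitmx ->
  mobius0 (rotation zeta *m h) = zeta ^+ n *: mobius0 h.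
Proof.
move=> z0 hu; rewrite mul_rotation /mobius0 block_mxKur block_mxKdr.
set b := zeta^-1 ^+ p; have b0 : b != 0 by rewrite expf_neq0 // invr_eq0.
have -> : invmx (b *: drsubmx h) = b^-1 *: invmx (drsubmx h).
  have bu : b *: drsubmx h \in unitmx by rewrite unitmxZ // unitfE.
  apply: (can_inj (mulKmx bu)); rewrite mulmxV // -scalemxAr -scalemxAl mulmxV //.
  by rewrite scalerA mulVf // scale1r.
by rewrite -scalemxAl -scalemxAr scalerA /b exprVn invrK -exprD addnC.
Qed.

Lemma det_weight_rotation zeta l (h : 'M[C]_n) : `|zeta| = 1 ->
  det_weight l (rotation zeta *m h) = det_weight l h.
Proof.
move=> z1; rewrite /det_weight mul_rotation block_mxKdr detZ Normc.normcM !normcX.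
have -> : normc zeta^-1 = 1.
  have nz1 : normc zeta = 1 by move: z1; rewrite normcE => /(congr1 (@complex.Re R)).
  by rewrite Normc.normcV nz1 invr1.
by rewrite !expr1n mul1r.
Qed.

Variable H : set 'M[C]_n.
Hypotheses (H_pu : forall g, H g -> pseudo_unitary g) (H_closed : closed H)
  (H_ldiv : ldiv_closed H) (H_rot : forall zeta, `|zeta| = 1 -> H (rotation zeta)).
Hypothesis n_gt0 : (0 < n)%N.
Variable nu : {measure set borel -> \bar R}.
Hypothesis H_haar : haar H nu.
Variable l : nat.
Hypothesis l_large : (min_weight p q <= l)%N.
Local Notation w := (@det_weight R p q (2 * l)).

(* Stands for [complex.Re] or [complex.Im]. *)
Variable rho : C -> R.
Hypotheses (rhoD : {morph rho : x y / x + y}) (rho_le : forall x, `|rho x| <= normc x)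
  (rho_c : continuous rho).

(** The left side is the limit of integrals in which a Neumann sum replaces the inverse; each of
    these already equals the right side, by averaging over rotations. *)
Lemma mean_value (g : 'M[C]_n) : pseudo_unitary g ->
  (\int[nu]_(h in (H : set borel))
      (rho ((\det (dlsubmx g *m mobius0 h + drsubmx g)) ^- l) * w h)%:E =
   (rho ((\det (drsubmx g)) ^- l))%:E * \int[nu]_(h in (H : set borel)) (w h)%:E)%E.
Proof.
move=> gU; set D := drsubmx g; set c0 := (\det D) ^- l; pose Y := invmx D *m dlsubmx g.
have Du : D \in unitmx by exact: drsubmx_unit.
have mH := measurable_group H_closed.
have [r [b [r01 rb]]] := ratio_neumann gU.
have b0 : 0 <= b.
  have [h hH] := haar_neq0 H_haar; have [_ hb] := rb _ (H_pu hH).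
  exact: le_trans (normc_ge0 _) (hb 0).
pose phi K (h : 'M[C]_n) := c0 * \det (neumann K (Y *m mobius0 h)) ^+ l.
pose f K (h : borel) := rho (phi K h) * w h.
have mobc h : H h -> mx_continuous_at h (@mobius0 C p q).
  by move=> hH; exact/mx_continuous_at_mobius0/drsubmx_unit/H_pu.
have rho_comp (u : 'M[C]_n -> C) h : continuous_at h u ->
    continuous_at h (fun x => rho (u x)).
  by move=> uc; exact: (cvg_comp _ _ uc (@rho_c _)).
have mf K : measurable_fun (H : set borel) (f K).
  apply: measurable_funM; last exact: (measurable_det_weight H_pu H_closed).
  apply: borel_measurable_fun => // h hH; apply: (rho_comp (phi K)).
  apply: (@continuous_atM C _ h (fun=> c0)); first exact: continuous_at_cst.
  apply: continuous_at_exp; apply: continuous_at_det; apply: mx_continuous_at_sum => k.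
  apply: mx_continuous_at_exp; under eq_fun do rewrite -scaleN1r.
  apply: (@mx_continuous_atZ C _ h _ _ (fun=> -1)); first exact: continuous_at_cst.
  by apply: mx_continuous_atM; [exact: mx_continuous_at_cst|exact: mobc].
pose B := normc c0 * b ^+ l.
have fB K h : pseudo_unitary h -> `|f K h| <= B * w h.
  move=> /rb[_ /(_ K) hb]; rewrite normrM [X in _ * X]ger0_norm ?det_weight_ge0 //.
  rewrite ler_wpM2r ?det_weight_ge0 //; apply: le_trans (rho_le _) _.
  rewrite Normc.normcM normcX ler_wpM2l ?normc_ge0 // lerXn2r ?nnegrE ?normc_ge0 //.
have iw := integrable_weight H_pu H_closed H_ldiv H_haar l_large.
have fin_w := integrable_fin_num mH iw.
(* Additivity gives multiplication by naturals; the value at 0 comes from [rho_le]. *)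
have rho_nat k x : rho (k%:R * x) = k%:R * rho x.
  elim: k => [|k ihk]; last by rewrite -!natr1 !mulrDl !mul1r rhoD ihk.
  rewrite !mul0r; apply/eqP; rewrite -normr_eq0 eq_le normr_ge0 andbT.
  by rewrite (le_trans (rho_le _)) // Normc.normc0.
have mean K : (\int[nu]_(h in (H : set borel)) (f K.+1 h)%:E =
    (rho c0)%:E * \int[nu]_(h in (H : set borel)) (w h)%:E)%E.
  (* [d] bounds the degree in t of the l-th power of a q by q determinant with entries of degree at
     most K + 1; N exceeds it, as [polyfun_mean] requires. *)
  pose d := (l * (q * K.+1))%N; pose N := d.+1.
  have Nn0 : (0 < N * n)%N by rewrite muln_gt0.
  (* Rotations scale by zeta^n; with zeta of order N n this is a primitive N-th root of unity. *)
  have [zeta zetaP] := has_primitive_root C Nn0.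
  have z1 j : `|zeta ^+ j| = 1 by rewrite normrX (norm_prim_root Nn0 zetaP) expr1n.
  have omegaP : N.-primitive_root (zeta ^+ n).
    by have := dvdn_prim_root zetaP (dvdn_mulr n (dvdnn N)); rewrite mulKn.
  pose k j := rotation (zeta ^+ j).
  have kH j : H (k j) by exact/H_rot/z1.
  have fk j h : H h -> f K.+1 (k j *m h) =
      rho (c0 * \det (neumann K.+1 ((zeta ^+ n) ^+ j *: (Y *m mobius0 h))) ^+ l) * w h.
    move=> hH; have hu := drsubmx_unit (H_pu hH).
    have z0 : zeta ^+ j != 0 by rewrite -normr_gt0 z1 ltr01.
    rewrite /f /phi (det_weight_rotation _ h (z1 j)) (mobius0_rotation z0 hu).
    by rewrite -scalemxAr (exprAC zeta j n).
  have sum_f h : H h -> \sum_(j < N) f K.+1 (k j *m h) = N%:R * rho c0 * w h.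
    move=> hH; under eq_bigr do rewrite fk //.
    rewrite -mulr_suml -rho_nat; congr (_ * _).
    have pf : polyfun d (fun t => \det (neumann K.+1 (t *: (Y *m mobius0 h))) ^+ l).
      by apply: polyfun_exp; exact: polyfun_neumann.
    have := polyfun_mean omegaP (ltnSn d) pf; rewrite scale0r neumann0 det1 expr1n mulr1.
    move=> sumN; rewrite mulrC -sumN mulr_sumr.
    apply/esym/big_morph => [x y|]; first exact: rhoD.
    by have := rho_nat 0%N 0; rewrite !mul0r.
  have mfk j : measurable_fun (H : set borel) (fun h : borel => f K.+1 (k j *m h)).
    apply: (measurable_comp mH _ (mf K.+1)); last first.
      by apply: measurable_funTS; exact: measurable_mulmx.
    by move=> _ [h hH <-]; exact: (G_mul H_pu H_ldiv H_haar).
  have ifk j : nu.-integrable (H : set borel) (fun h => (f K.+1 (k j *m h))%:E).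
    apply: (integrable_le_weight H_pu H_closed H_ldiv H_haar l_large (c := B) (mfk j)).
    move=> h hH; rewrite -(det_weight_rotation _ h (z1 j)); apply: fB.
    exact/H_pu/(G_mul H_pu H_ldiv H_haar).
  have if_ : nu.-integrable (H : set borel) (fun h => (f K.+1 h)%:E).
    apply: (integrable_le_weight H_pu H_closed H_ldiv H_haar l_large (c := B) (mf _)).
    by move=> h hH; apply: fB; exact: H_pu.
  have [x eqx] : exists x, (\int[nu]_(h in (H : set borel)) (f K.+1 h)%:E = x%:E)%E.
    exists (fine (\int[nu]_(h in (H : set borel)) (f K.+1 h)%:E)%E).
    by rewrite fineK // integrable_fin_num.
  (* By [integral_translate] the N rotated integrals all equal the original one; under the integral
     sign their sum is given by [sum_f]. *)
  have eqI : (N%:R%:E * \int[nu]_(h in (H : set borel)) (f K.+1 h)%:E =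
      (N%:R * rho c0)%:E * \int[nu]_(h in (H : set borel)) (w h)%:E)%E.
    rewrite -(integralZl mH iw).
    transitivity (\sum_(j < N) \int[nu]_(h in (H : set borel)) (f K.+1 (k j *m h))%:E)%E.
      rewrite eqx -EFinM mulr_natl -[in LHS](card_ord N) -sumr_const -sumEFin.
      apply: eq_bigr => j _; rewrite -eqx; apply/esym.
      exact: (integral_translate H_pu H_closed H_ldiv H_haar (kH j) (mf _) (ifk j)).
    rewrite -integral_sum //; apply: eq_integral => h; rewrite inE => hH.
    by rewrite sumEFin sum_f.
  move: eqI; rewrite eqx -(fineK fin_w) -!EFinM => -[]; rewrite -mulrA.
  by move/mulfI => ->; rewrite // pnatr_eq0.
have lim_f h : H h -> (f K.+1 h)%:E @[K --> \oo] -->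
    (rho ((\det (dlsubmx g *m mobius0 h + D)) ^- l) * w h)%:E.
  move=> hH; have [Mr nb] := rb _ (H_pu hH).
  have [P0 lim] := det_neumann_cvg r01 Mr nb; set M := _ *m mobius0 h in P0 lim.
  (* Factor D out of the automorphy factor: C z + D = D (1 + Y z), with C the lower left block. *)
  have -> : (\det (dlsubmx g *m mobius0 h + D)) ^- l = c0 * (\det (1%:M + M))^-1 ^+ l.
    have -> : \det (dlsubmx g *m mobius0 h + D) = \det D * \det (1%:M + M).
      rewrite -det_mulmx mulmxDr mulmx1 addrC; congr (\det (_ + _)).
      by rewrite /M -mulmxA (mulKVmx Du).
    by rewrite exprMn invfM (exprVn (\det (1%:M + M)) l).
  pose Phi (y : C) : R := rho (c0 * y ^+ l) * w h.
  have Phic : continuous Phi.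
    move=> y; have c1 : continuous_at y (fun y : C => c0 * y ^+ l).
      apply: (@continuous_atM C _ y (fun=> c0)); first exact: continuous_at_cst.
      by apply: continuous_at_exp; exact: cvg_id.
    apply: (@continuous_atM R _ y (fun y => rho (c0 * y ^+ l)) (fun=> w h)).
      exact: (cvg_comp _ _ c1 (@rho_c _)).
    exact: continuous_at_cst.
  apply: cvg_EFin; first exact: nearW.
  have limS : \det (neumann K.+1 M) @[K --> \oo] --> (\det (1%:M + M))^-1.
    by have := lim; rewrite -(cvg_shiftS (fun K => \det (neumann K M))).
  exact: (cvg_comp _ _ limS (@Phic _)).
have mlim : measurable_fun (H : set borel) (fun h : borel =>
    (rho ((\det (dlsubmx g *m mobius0 h + D)) ^- l) * w h)%:E).
  apply: (emeasurable_fun_cvg (fun K h => (f K.+1 h)%:E)); last exact: lim_f.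
  by move=> K; apply/measurable_EFinP; exact: mf.
have mfE K : measurable_fun (H : set borel) (fun h : borel => (f K.+1 h)%:E).
  by apply/measurable_EFinP; exact: mf.
have := @dominated_convergence _ _ _ nu _ mH (fun K h => (f K.+1 h)%:E) _
  (fun h => B%:E * (w h)%:E)%E mfE mlim.
case=> [| | |_ _ limI].
- by apply: aeW => h; exact: lim_f.
- exact: integrableZl.
- by apply: aeW => h K hH; rewrite lee_fin; apply: fB; exact: H_pu.
(* The integrals do not depend on K, so the limit is their common value. *)
apply: (cvg_unique (@ereal_hausdorff R) limI).
rewrite (_ : (fun K => _) = (fun=> (rho c0)%:E * \int[nu]_(h in (H : set borel)) (w h)%:E)%E).
  exact: cvg_cst.
by apply/funext => K; exact: mean.
Qed.
End MeanValue.

(** * Matrix coefficients and the extension *)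

Section MatrixCoefficients.
Variables (R : realType) (p q : nat).
Local Notation C := R[i].
Local Notation n := (p + q)%N.
Local Notation borel := (borel_mx R n).
Local Notation normc := (@Normc.normc R).

Lemma psiE (l : nat) (g : 'M[C]_n) : psi l g = \det (drsubmx (invmx g)) ^- l.
Proof. by rewrite /psi -exprnN. Qed.

Lemma normc_conj (x : C) : normc x^* = normc x.
Proof. by apply: (@complexI R); rewrite -[LHS]normcE -[RHS]normcE norm_conjC. Qed.

(** The lower right block of g^-1 is the adjoint of that of g, so both determinants have the same
    modulus. *)
Lemma normc_psi (l : nat) (g : 'M[C]_n) : pseudo_unitary g -> normc (psi l g) = det_weight l g.
Proof.
move=> gU; rewrite psiE drsubmx_inv // det_adjmx Normc.normcV normcX normc_conj //.
Qed.

Lemma mobius_0 (g : 'M[C]_n) : mobius g 0 = mobius0 g.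
Proof. by rewrite /mobius /automorphy !mulmx0 !add0r. Qed.

Lemma weight_mobius0 (l : nat) (g : 'M[C]_n) : pseudo_unitary g ->
  weight l (mobius0 g) = det_weight (2 * l) g.
Proof.
move=> gU; rewrite /weight adj_mobius0 // det_mulmx det_adjmx mulrC -normCK normcE det_inv.
rewrite Normc.normcV -rmorphXn /= /det_weight exprM -!exprVn.
by rewrite -exprnP.
Qed.

Lemma Re_mulr (x : C) (r : R) : complex.Re (x * r%:C%C) = complex.Re x * r.
Proof. by case: x => a b /=; rewrite mulr0 subr0. Qed.

Lemma Im_mulr (x : C) (r : R) : complex.Im (x * r%:C%C) = complex.Im x * r.
Proof. by case: x => a b /=; rewrite mulr0 add0r. Qed.

Lemma normRe_le (x : C) : `|complex.Re x| <= normc x.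
Proof. by rewrite -lecR -normcE normRe. Qed.

Lemma normIm_le (x : C) : `|complex.Im x| <= normc x.
Proof. by rewrite -lecR -normcE normIm. Qed.

Lemma normc_leD (x y : C) : normc (x + y) <= normc x + normc y.
Proof. by have := ler_normD x y; rewrite !normcE -rmorphD lecR. Qed.

Section SeriesGroup.
Variable H : set 'M[C]_n.
Hypotheses (H_pu : forall g, H g -> pseudo_unitary g) (H_closed : closed H)
  (H_ldiv : ldiv_closed H) (H_rot : forall zeta, `|zeta| = 1 -> H (rotation p q zeta)).
Hypothesis n_gt0 : (0 < n)%N.
Variable nu : {measure set borel -> \bar R}.
Hypothesis H_haar : haar H nu.
Variable l : nat.
Hypothesis l_large : (min_weight p q <= l)%N.

Lemma bergman_space_1 : bergman_space H nu l (cst 1).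
Proof.
split; first by move=> x _; exists setT, (cst 1); split => //; exact: openT.
apply: eq_integrable (integrable_weight H_pu H_closed H_ldiv H_haar l_large).
  exact: measurable_group.
move=> h; rewrite inE => hH /=.
by rewrite mobius_0 (weight_mobius0 l (H_pu hH)) expr0n /= addr0 expr1n sqrtr1 expr1n mul1r.
Qed.

(** As [series_rep] inverts its argument, [invmx g] produces the automorphy factor of g itself; the
    real and imaginary parts are then two instances of [mean_value]. *)
Lemma bergman_inner_series (g : 'M[C]_n) : pseudo_unitary g ->
  bergman_inner H nu l (series_rep l (invmx g) (cst 1)) (cst 1) =
  (\det (drsubmx g)) ^- l *
  (fine (\int[nu]_(h in (H : set borel)) (det_weight (2 * l) h)%:E)%E)%:C%C.
Proof.
move=> gU; set I := (\int[nu]_(h in _) _)%E.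
have Ifin : I \is a fin_num.
  apply: integrable_fin_num; first exact: measurable_group.
  exact: (integrable_weight H_pu H_closed H_ldiv H_haar l_large).
have val (rho : C -> R) : {morph rho : x y / x + y} -> (forall x, `|rho x| <= normc x) ->
    continuous rho -> (forall x r, rho (x * r%:C%C) = rho x * r) ->
    Rintegral nu (H : set borel) (fun h => let z := mobius h 0 in
      rho (series_rep l (invmx g) (cst 1) z * (cst 1 z)^* * (weight l z)%:C%C)) =
    rho (\det (drsubmx g) ^- l) * fine I.
  move=> rhoD rho_le rho_c rhoM; rewrite /Rintegral.
  transitivity (fine ((rho (\det (drsubmx g) ^- l))%:E * I)%E); last by rewrite fineM.
  congr fine.
  rewrite -(mean_value H_pu H_closed H_ldiv H_rot n_gt0 H_haar l_large rhoD rho_le rho_c gU).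
  apply: eq_integral => h; rewrite inE => hH; congr (_%:E).
  rewrite /= rmorph1 mulr1 rhoM mobius_0 (weight_mobius0 l (H_pu hH)).
  by rewrite /series_rep /automorphy invmxK mulr1 -exprnN.
apply/eqP; rewrite eq_complex; apply/andP; split; apply/eqP.
  rewrite Re_mulr; apply: (val (@complex.Re R)).
  - by move=> [a b] [c d].
  - exact: normRe_le.
  - exact: Re_continuous.
  - exact: Re_mulr.
rewrite Im_mulr; apply: (val (@complex.Im R)).
- by move=> [a b] [c d].
- exact: normIm_le.
- exact: Im_continuous.
- exact: Im_mulr.
Qed.

(** The numerator is [bergman_inner_series] at g^-1, the denominator the same formula at the
    identity, which fixes the constant 1; the integral of the weight cancels. *)
Lemma series_coeff_psi (g : 'M[C]_n) : pseudo_unitary g ->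
  series_coeff H nu l g = psi l g.
Proof.
move=> gU; rewrite psiE /series_coeff.
have I0 := integral_weight_gt0 H_pu H_closed H_haar l.
have If : (\int[nu]_(h in (H : set borel)) (det_weight (2 * l) h)%:E)%E \is a fin_num.
  apply: integrable_fin_num; first exact: measurable_group.
  exact: (integrable_weight H_pu H_closed H_ldiv H_haar l_large).
have gE := bergman_inner_series (pseudo_unitaryV gU).
rewrite invmxK in gE.
have one_pu : pseudo_unitary (1%:M : 'M[C]_n).
  by rewrite /pseudo_unitary adjmx1 mul1mx mulmx1.
have dr1 : drsubmx (1%:M : 'M[C]_n) = 1%:M by rewrite scalar_mx_block block_mxKdr.
have dl1 : dlsubmx (1%:M : 'M[C]_n) = 0 by rewrite scalar_mx_block block_mxKdl.
have eq1 : series_rep l (invmx (1%:M : 'M[C]_n)) (cst 1) = cst 1.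
  apply/funext => z; rewrite /series_rep /automorphy invmxK dl1 dr1 mul0mx add0r det1.
  by rewrite exp1rz mulr1.
have oneE := bergman_inner_series one_pu.
rewrite eq1 dr1 det1 expr1n invr1 mul1r in oneE.
have If0 : fine (\int[nu]_(h in (H : set borel)) (det_weight (2 * l) h)%:E)%E != 0.
  by rewrite gt_eqF // fine_gt0 // I0 ltey_eq If.
rewrite gE oneE mulfK //.
by apply: contra_neq If0 => /(congr1 (@complex.Re R)).
Qed.

End SeriesGroup.

(** * Holomorphy and square integrability of the extension *)

Section Extension.
Variable G : set 'M[C]_n.
Hypothesis G_SU : G `<=` SU R p q.
Variables (s : seq int) (a : int -> C).
Hypothesis s_large : forall l : int, l \in s -> exists2 k : nat, l = k & (min_weight p q <= k)%N.
Let W (x : 'M[C]_n) : C := \sum_(l <- s) a l * psi l x.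

(** On [SU] the determinant is 1 and the inverse is the adjugate, so W is there a rational function
    of the entries, regular on an open set of matrices containing G. The exponents in [s] are
    nonnegative, so the absolute value only changes their type. *)
Definition entire_psi (x : 'M[C]_n) : C := \sum_(l <- s) a l * \det (drsubmx (\adj x)) ^- `|l|%N.

Lemma entire_psiE x : G x -> W x = entire_psi x.
Proof.
move=> /G_SU[xU x1]; rewrite /W /entire_psi big_seq [RHS]big_seq; apply: eq_bigr => l ls.
have [k -> _] := s_large ls; rewrite psiE /=; congr (_ * (\det (drsubmx _)) ^- k).
by rewrite /invmx pseudo_unitary_unit // x1 invr1 scale1r.
Qed.

Lemma entire_psi_domain x : G x -> \det (drsubmx (\adj x)) != 0.
Proof.
move=> /G_SU[xU x1]; rewrite -unitfE -unitmxE.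
have -> : \adj x = invmx x by rewrite /invmx pseudo_unitary_unit // x1 invr1 scale1r.
exact/drsubmx_unit/pseudo_unitaryV.
Qed.

Lemma differentiable_det_adj (x : 'M[C]_n) : differentiable (fun y : 'M[C]_n => \det (drsubmx (\adj y))) x.
Proof.
apply: differentiable_det => i j.
have drE (y : 'M[C]_n) : drsubmx (\adj y) i j = (\adj y) (rshift p i) (rshift p j).
  by rewrite !mxE.
under eq_fun do rewrite drE.
by apply: differentiable_adj => k m; exact: differentiable_coord.
Qed.

Lemma differentiable_entire_psi (x : 'M[C]_n) : \det (drsubmx (\adj x)) != 0 -> differentiable entire_psi x.
Proof.
move=> x0; apply: differentiable_big_sum => l.
apply: (@differentiableM _ _ (fun=> a l)); first exact: differentiable_cst.
apply: differentiable_exprV => //; exact: differentiable_det_adj.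
Qed.

Lemma holomorphic_W : holomorphic_on G W.
Proof.
move=> x Gx; exists [set y : 'M[C]_n | \det (drsubmx (\adj y)) != 0], entire_psi; split.
- rewrite (_ : mkset _ = (fun y : 'M[C]_n => \det (drsubmx (\adj y))) @^-1` ~` [set 0]); last first.
    by apply/seteqP; split=> y /eqP.
  apply: open_comp => [y _|]; first exact/differentiable_continuous/differentiable_det_adj.
  apply: closed_openC; apply: accessible_closed_set1; apply: hausdorff_accessible.
  exact: (@norm_hausdorff C C^o).
- exact: entire_psi_domain.
- by move=> y; exact: differentiable_entire_psi.
- by move=> y _; exact: entire_psiE.
Qed.

Hypotheses (G_closed : closed G) (G_ldiv : ldiv_closed G).

(** Since |\det D| >= 1 / q!, each term with exponent at least L is bounded by a constant times
    |\det D|^-L, whose square is integrable by the choice of [min_weight]. *)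
Lemma square_integrable_W : square_integrable G W.
Proof.
have G_pu g : G g -> pseudo_unitary g by move/G_SU/SU_pseudo_unitary.
have mG : measurable (G : set borel) by exact: borel_closed.
have mW (rho : C -> R) : continuous rho -> measurable_fun (G : set borel) (fun g : borel => rho (W g)).
  move=> rho_c; apply: (@eq_measurable_fun _ _ _ _ _ (fun g : borel => rho (entire_psi g))).
    by move=> g; rewrite inE => gG; rewrite entire_psiE.
  apply: borel_measurable_fun => // g gG.
  have c1 := differentiable_continuous (differentiable_entire_psi (entire_psi_domain gG)).
  exact: (cvg_comp _ _ c1 (@rho_c _)).
split=> [||mu G_haar].
- exact: (mW _ (@Re_continuous R)).
- exact: (mW _ (@Im_continuous R)).
pose L := min_weight p q.
pose B := \sum_(l <- s) normc (a l) * q`!%:R ^+ (`|l|%N - L).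
have W_le g : G g -> normc (W g) <= B * det_weight L g.
  move=> gG; have gU := G_pu _ gG.
  have dw k : det_weight k g <= q`!%:R ^+ k.
    have d0 : 0 < normc (\det (drsubmx g)).
      by rewrite normc_gt0 -unitfE -unitmxE drsubmx_unit.
    rewrite /det_weight -exprVn lerXn2r ?nnegrE ?invr_ge0 ?(ltW d0) //.
    rewrite -[_^-1]mul1r ler_pdivrMr // -lecR rmorphM /= rmorph_nat -normcE.
    exact: det_drsubmx_ge.
  rewrite /W /B mulr_suml big_seq [leRHS]big_seq.
  elim/big_ind2 : _ => [|x1 x2 y1 y2 le1 le2|l ls]; first by rewrite Normc.normc0.
    by apply: le_trans (normc_leD _ _) _; exact: lerD.
  have [k -> Lk] := s_large ls; rewrite Normc.normcM normc_psi //= -mulrA.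
  rewrite ler_wpM2l ?normc_ge0 //.
  have -> : det_weight k g = det_weight (k - L) g * det_weight L g.
    by rewrite /det_weight -invfM -exprD subnK.
  by rewrite ler_wpM2r ?det_weight_ge0 // dw.
have iW : mu.-integrable (G : set borel) (EFin \o (fun g : borel => normc (W g) ^+ 2)).
  apply: (integrable_le_weight G_pu G_closed G_ldiv G_haar (leqnn L) (c := B ^+ 2)).
    by apply: measurable_funX; apply: mW; exact: normc_continuous.
  move=> g gG; rewrite ger0_norm ?exprn_ge0 ?normc_ge0 //.
  rewrite /det_weight mulnC exprM -[(_ ^+ 2)^-1]exprVn -exprMn lerXn2r ?nnegrE ?normc_ge0 //.
    exact: le_trans (normc_ge0 _) (W_le _ gG).
  exact: W_le.
exact: integrable_lty iW.
Qed.

End Extension.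
End MatrixCoefficients.

(** Z = -1 gives the form defining [Sp], and Z = 1 the one defining [SOstar]. *)
Lemma antidiag_form (F : comPzRingType) m (Z : 'M[F]_m) (u v : F) : u * v = 1 ->
  (block_mx u%:M 0 0 v%:M : 'M[F]_(m + m))^T *m (block_mx 0 1%:M Z 0 : 'M[F]_(m + m))
    *m (block_mx u%:M 0 0 v%:M : 'M[F]_(m + m)) = block_mx 0 1%:M Z 0.
Proof.
move=> uv; rewrite tr_block_mx !tr_scalar_mx !trmx0 !mulmx_block.
rewrite !(mul0mx, mulmx0, addr0, add0r, mulmx1) -scalar_mxM uv.
by rewrite mul_scalar_mx mul_mx_scalar scalerA uv scale1r.
Qed.

Section Rotations.
Variable R : realType.
Local Notation C := R[i].

(** For [TypeSp] and [TypeSOstar] both blocks have size m, so the diagonal scalars zeta^m and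
    zeta^-m are mutually inverse, as [antidiag_form] requires; for [TypeSO2] the rotations are taken
    in SU(p, 2). *)
Lemma series_group_rotation (T : hermitian_type) (zeta : C) : `|zeta| = 1 ->
  series_group R T (rotation (ulsize T) (drsize T) zeta).
Proof.
move=> z1; have z0 : zeta != 0 by rewrite -normr_gt0 z1.
have rSU p q : SU R p q (rotation p q zeta).
  by split; [exact: rotation_pseudo_unitary|exact: det_rotation].
have uv m : zeta ^+ m * zeta^-1 ^+ m = 1 by rewrite -exprMn mulfV // expr1n.
case: T => [p q|m|m|p]; [exact: rSU| | |exact: rSU];
  by split; [exact: rSU|exact: antidiag_form].
Qed.

End Rotations.

(** * Vandermonde interpolation and construction of the extension *)

Lemma vandermonde_interpolation (F : fieldType) n (x y : 'I_n -> F) : injective x ->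
  exists c : 'I_n -> F, forall j, \sum_i c i * x j ^+ i = y j.
Proof.
move=> x_inj; pose V := Vandermonde n (\row_j x j).
have Vu : V \in unitmx.
  rewrite unitmxE unitfE det_Vandermonde; apply/prodf_neq0 => i _.
  apply/prodf_neq0 => j ij; rewrite !mxE subr_eq0; apply: contraTneq ij => /x_inj ->.
  by rewrite ltnn.
exists (fun i => (\row_j y j *m invmx V) 0 i) => j.
have : (\row_j y j *m invmx V *m V) 0 j = y j by rewrite mulmxKV // mxE.
by rewrite mxE => <-; apply: eq_bigr => i _; rewrite !mxE.
Qed.

Theorem theorem6p1 (R : realType) (T : hermitian_type)
    (K : set 'M[R[i]]_(ulsize T + drsize T))
    (G_noncompact : ~ compact (hermitian_group R T))
    (K_maximal : maximal_compact_subgroup (hermitian_group R T) K)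
    (G_hermitian :
      lie_centralizer (lie (hermitian_group R T)) (lie_center (lie K)) = lie K)
    (n : nat) (g : 'I_n -> 'M[R[i]]_(ulsize T + drsize T))
    (g_in_G : forall j, hermitian_group R T (g j))
    (detD_distinct : injective (fun j => \det (drsubmx (invmx (g j)))))
    (f : 'M[R[i]]_(ulsize T + drsize T) -> R[i])
    (f_nonconstant : exists i j, f (g i) <> f (g j)) :
  exists (s : seq int) (a : int -> R[i]), uniq s /\
    let W := fun x : 'M[R[i]]_(ulsize T + drsize T) => \sum_(l <- s) a l * psi l x in
    [/\ series_coeff_span R T W,
        square_integrable (hermitian_group R T) W
      & whitney_extension (hermitian_group R T) (range g) f W].
Proof.
have G_SU : hermitian_group R T `<=` SU R (ulsize T) (drsize T).
  by move=> x /hermitian_group_sub/series_group_SU.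
(* Matrices of size 0 are all equal, so [f] could not take two values on the g_j. *)
have size_gt0 : (0 < ulsize T + drsize T)%N.
  rewrite lt0n; apply/negP => /eqP N0; case: f_nonconstant => i [j]; apply; congr f.
  by apply/matrixP => k; have := ltn_ord k; rewrite [X in (_ < X)%N]N0.
pose L := min_weight (ulsize T) (drsize T).
pose d j := \det (drsubmx (invmx (g j))).
have d0 j : d j != 0.
  rewrite -unitfE -unitmxE; apply: drsubmx_unit; apply: pseudo_unitaryV.
  exact/SU_pseudo_unitary/G_SU.
have dV_inj : injective (fun j => (d j)^-1) by move=> i j /invr_inj/detD_distinct.
(* The nodes are the d_j^-1. The factor d_j^L compensates the shift of the exponents by L, since
   psi_(L + i) takes the value d_j^-L d_j^-i at g_j. *)
have [c cE] := vandermonde_interpolation (fun j => f (g j) * d j ^+ L) dV_inj.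
pose ex (i : 'I_n) : int := (L + i)%N.
have ex_inj : injective ex by move=> i j [] /addnI/val_inj.
pose s := [seq ex i | i <- enum 'I_n].
(* Carries the coefficients from indices to exponents; [ex] being injective, the sum has at most one
   term. *)
pose a (l : int) := \sum_(i | ex i == l) c i.
have aE i : a (ex i) = c i.
  rewrite /a (bigD1 i) //= big1 ?addr0 // => j /andP[/eqP/ex_inj ->].
  by rewrite eqxx.
have s_large (l : int) : l \in s ->
    exists2 k : nat, l = k & (min_weight (ulsize T) (drsize T) <= k)%N.
  by move=> /mapP[i _ ->]; exists (L + i)%N => //; exact: leq_addr.
exists s, a; split; first by rewrite map_inj_uniq ?enum_uniq.
move=> W; split.
- exists s, a => nu nu_haar; split=> [l /s_large[k -> Lk]|x Gx].
    apply: bergman_space_1 => //.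
    + by move=> x /series_group_SU/SU_pseudo_unitary.
    + exact: closed_series_group.
    + exact: series_group_ldiv.
  rewrite /W big_seq [RHS]big_seq; apply: eq_bigr => l /s_large[k -> Lk].
  congr (_ * _); apply/esym; apply: series_coeff_psi => //.
  + by move=> y /series_group_SU/SU_pseudo_unitary.
  + exact: closed_series_group.
  + exact: series_group_ldiv.
  + exact: series_group_rotation.
  + exact/SU_pseudo_unitary/G_SU.
- apply: square_integrable_W => //; first exact: closed_hermitian_group.
  exact: hermitian_group_ldiv.
split; first exact: holomorphic_W.
move=> _ [j _ <-]; rewrite /W big_map big_enum /=.
transitivity (\sum_i (d j)^-1 ^+ L * (c i * (d j)^-1 ^+ i)).
  apply: eq_bigr => i _; rewrite aE psiE -/(d j) -exprVn exprD.
  by rewrite mulrCA.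
by rewrite -mulr_sumr cE mulrCA -exprMn mulVf // expr1n mulr1.
Qed.
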